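(* For $\nu\in\mathbb{R}$ let $$\mathcal{A}_\nu(z)=2\sum_{n\ge 0}\frac{(-1)^n z^{2n}}{n!\,\Gamma(\nu+n+1)\Gamma(\nu+2n+2)},\qquad \mathcal{B}_\nu(z)=\sum_{n\ge 0}\frac{(-1)^n z^{2n}}{n!\,\Gamma(\nu+n+1)\Gamma(\nu+2n+1)}.$$ If $\nu>-1$, then all zeros of $\mathcal{A}_\nu(z)$ and $\mathcal{B}_\nu(z)$ are real. Moreover, if $\nu>-1$, then all zeros of $\mathcal{A}_\nu(\sqrt{z})$ and $\mathcal{B}_\nu(\sqrt{z})$ (as entire functions of $z$) are real and positive. In addition, if $\nu\ge 0$, then $\mathcal{A}_{-\nu}(z)$ and $\mathcal{B}_{-\nu}(z)$ have at most $4[\nu]$ complex zeros.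
   Context: $1/\Gamma$ is the entire reciprocal gamma function, vanishing at $0,-1,-2,\dots$. The functions arise as $\mathcal{A}_\nu(z)=z^{\frac{-2\nu-1}{2}}\Phi_\nu(2\sqrt{z})$ and $\mathcal{B}_\nu(z)=z^{-\nu}\Pi_\nu(2\sqrt{z})$, where $\Phi_\nu(z)=J_\nu(z)I_\nu'(z)-I_\nu(z)J_\nu'(z)$ and $\Pi_\nu(z)=J_\nu(z)I_\nu(z)$, with $J_\nu$, $I_\nu$ the Bessel and modified Bessel functions of the first kind. Since $\mathcal{A}_\nu$ and $\mathcal{B}_\nu$ are power series in $z^2$, $\mathcal{A}_\nu(\sqrt z)$ and $\mathcal{B}_\nu(\sqrt z)$ are entire functions of $z$, obtained by replacing $z^{2n}$ by $z^n$ in the series. ''Complex zeros'' means nonreal zeros, counted with multiplicity. $[x]$ denotes the integer part (floor) of $x$. *)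

(* Defs.v *)
From HB Require Import structures.
From mathcomp Require Import all_boot all_order all_algebra.
From mathcomp Require Import complex.
From mathcomp Require Import all_classical all_reals all_analysis.

Set Implicit Arguments.
Unset Strict Implicit.
Unset Printing Implicit Defensive.

Import Order.TTheory GRing.Theory Num.Theory numFieldNormedType.Exports.

Local Open Scope classical_set_scope.
Local Open Scope ring_scope.
Local Open Scope complex_scope.

(* The reciprocal gamma function 1/Gamma on the real line, as the Euler-Gauss
   product: 1/Gamma(x) is the limit of x (x+1) ... (x+n) / (n! n^x). The limit
   exists for every real x and is 0 at x = 0, -1, -2, ...: no case distinction
   is needed at the poles of Gamma. *)
Definition rGamma (R : realType) (x : R) : R :=
  lim ((fun n : nat =>
          (\prod_(k < n.+1) (x + k%:R)) / (n`!%:R * n%:R `^ x)) @ \oo).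

Definition funA_coef (R : realType) (nu : R) (n : nat) : R :=
  (-1) ^+ n / n`!%:R * rGamma (nu + n%:R + 1) * rGamma (nu + (2 * n)%:R + 2).

Definition funB_coef (R : realType) (nu : R) (n : nat) : R :=
  (-1) ^+ n / n`!%:R * rGamma (nu + n%:R + 1) * rGamma (nu + (2 * n)%:R + 1).

(* R[i]^o is the complex field R[i] seen as a normed module over itself: this
   is the type that carries the usual topology of the complex plane. *)
Definition funA (R : realType) (nu : R) (z : R[i]^o) : R[i]^o :=
  2 * lim ([series ((funA_coef nu n)%:C * z ^+ (2 * n) : R[i]^o)]_n @ \oo).

Definition funB (R : realType) (nu : R) (z : R[i]^o) : R[i]^o :=
  lim ([series ((funB_coef nu n)%:C * z ^+ (2 * n) : R[i]^o)]_n @ \oo).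

(* The entire functions usually written A_nu(sqrt z) and B_nu(sqrt z); see
   funA_sqrtE and funB_sqrtE. *)
Definition funA_sqrt (R : realType) (nu : R) (z : R[i]^o) : R[i]^o :=
  2 * lim ([series ((funA_coef nu n)%:C * z ^+ n : R[i]^o)]_n @ \oo).

Definition funB_sqrt (R : realType) (nu : R) (z : R[i]^o) : R[i]^o :=
  lim ([series ((funB_coef nu n)%:C * z ^+ n : R[i]^o)]_n @ \oo).

Lemma funA_sqrtE (R : realType) (nu : R) (z : R[i]) :
  funA_sqrt nu (z ^+ 2) = funA nu z.
Proof.
rewrite /funA_sqrt /funA.
by under eq_fun do rewrite -exprM.
Qed.

Lemma funB_sqrtE (R : realType) (nu : R) (z : R[i]) :
  funB_sqrt nu (z ^+ 2) = funB nu z.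
Proof.
rewrite /funB_sqrt /funB.
by under eq_fun do rewrite -exprM.
Qed.

(* The derivatives are complex derivatives, the scalar field being R[i]. *)
Definition zero_order_ge (R : realType) (f : R[i]^o -> R[i]^o) (z : R[i])
    (m : nat) : Prop :=
  forall k : nat, (k < m)%N -> derive1n k f z = 0.

(* f has at most N nonreal zeros, counted with multiplicity. Any lower bounds
   m z on the orders of finitely many distinct nonreal zeros add up to at most
   N; in particular a nonreal zero of infinite order is ruled out. *)
Definition at_most_nonreal_zeros (R : realType) (f : R[i]^o -> R[i]^o)
    (N : nat) : Prop :=
  forall (s : seq R[i]) (m : R[i] -> nat), uniq s ->
    {in s, forall z, z \isn't Num.real /\ zero_order_ge f z (m z)} ->
    (\sum_(z <- s) m z <= N)%N.

(* Main.v *)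
(* Replacing 1/Gamma by its Euler-Gauss products turns the power series into
   polynomials obtained from a polynomial with simple positive zeros by applying
   operators p |-> x p' + a p = x^(1-a) (x^a p)'. By Rolle's theorem such an operator
   with a > 0 preserves the number of positive zeros, and with a <= 0 it loses at most
   one; at most 2[nu] of the parameters are nonpositive, so the approximating polynomials
   have at most 2[nu] zeros outside [0, oo).
   The bound passes to the limit f without contour integrals. Write an approximant as
   a * prod_u (1 - u z) * prod_x (1 - x z), with few u and all x >= 0. Its first
   coefficients bound sum_x x, hence prod_x |1 - x z0| from below at every z0 outside
   [0, oo). If f(z0) = 0, some u therefore tends to 1/z0, and dividing by 1 - u z shows
   that f / (1 - z/z0) is a limit of approximants with one factor u less. Iterating
   bounds the multiplicities; replacing z by z^2 doubles the count. *)

Require Import Defs.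
From mathcomp Require Import all_boot all_order all_algebra.
From mathcomp Require Import complex.
From mathcomp Require Import all_classical all_reals all_analysis.
From mathcomp Require Import ring lra zify.

Set Implicit Arguments.
Unset Strict Implicit.
Unset Printing Implicit Defensive.

Import Order.TTheory GRing.Theory Num.Theory numFieldNormedType.Exports.
Import Normc.

Local Open Scope classical_set_scope.
Local Open Scope ring_scope.
Local Open Scope complex_scope.


(** * Entire power series over the complex numbers *)

(** The operator [x p' + a p] multiplies [x^n] by [n + a]. The numerators of the products for
    [1/Gamma(n + al)] and [1/Gamma(2 n + be)] thus come from [a = al + k] and [a = (be + k) / 2],
    and the remaining [N^(3 n)] in the denominator is a rescaling of the variable in a polynomial
    approximating exp(-x). That polynomial cannot be [(1 - x/N)^N], since Rolle's theorem is applied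
    between distinct zeros; its zeros are spread slightly. Coefficientwise convergence alone does
    not control zeros. What is carried along is a majorant [K rho] of the coefficients, the same for
    all approximants; division by [1 - u X] keeps one because [u] stays away from 0. For [- nu] with
    [nu] a positive integer the first coefficients vanish, so the argument runs on the shifted
    series; this only discards a zero at the origin, which is real. If all parameters are positive,
    there are no exceptional factors [u], hence no zeros outside [0, oo): the claim for [nu > -1]
    and the count for [- nu] are instances of one statement. *)

Lemma normcE (R : realType) (z : R[i]) : `|z| = (normc z)%:C.
Proof. by rewrite normc_def; case: z => a b /=. Qed.

Lemma normc_ge0 (R : realType) (z : R[i]) : 0 <= normc z.
Proof. by case: z => a b; exact: sqrtr_ge0. Qed.

Lemma normc_gt0 (R : realType) (z : R[i]) : (0 < normc z) = (z != 0).
Proof.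
rewrite lt_neqAle normc_ge0 andbT eq_sym; congr negb.
by apply/eqP/eqP => [/eq0_normc|->] //; exact: normc0.
Qed.

Lemma normcX (R : realType) (z : R[i]) n : normc (z ^+ n) = normc z ^+ n.
Proof. by elim: n => [|n IHn]; rewrite ?normc1 // !exprS normcM IHn. Qed.

Lemma normcR (R : realType) (x : R) : normc x%:C = `|x|.
Proof. by rewrite /= expr0n /= addr0 sqrtr_sqr. Qed.

Lemma ler_normcD (R : realType) (x y : R[i]) :
  normc (x + y) <= normc x + normc y.
Proof. exact: le_normcD. Qed.

Lemma ler_normcB (R : realType) (x y : R[i]) :
  normc (x - y) <= normc x + normc y.
Proof. by rewrite -(normcN (y : Rcomplex R)) ler_normcD. Qed.

Lemma normc_distC (R : realType) (x y : R[i]) : normc (x - y) = normc (y - x).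
Proof. by rewrite -normcN opprB. Qed.

Lemma ler_normc_sum (R : realType) (I : Type) (r : seq I) (P : pred I)
    (F : I -> R[i]) :
  normc (\sum_(i <- r | P i) F i) <= \sum_(i <- r | P i) normc (F i).
Proof.
elim/big_rec2: _ => [|i y x _ h]; first by rewrite normc0.
by apply: le_trans (ler_normcD _ _) _; rewrite lerD2l.
Qed.

(** A positive element of [R[i]] is real, so real epsilons suffice to test convergence. *)
Lemma cvg_normcP (R : realType) (u : nat -> R[i]^o) (l : R[i]^o) :
  u @ \oo --> l <-> forall e : R, 0 < e ->
    exists N, forall n, (N <= n)%N -> normc (l - u n) < e.
Proof.
rewrite cvgrPdist_lt; split=> [h e e0|h e].
  have [|N _ hN] := h e%:C; first by rewrite ltcR.
  by exists N => n /hN /=; rewrite normcE ltcR.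
rewrite ltcE /= => /andP[/eqP Ime e0]; have [N hN] := h _ e0.
exists N => // n /= /hN; rewrite normcE -ltcR; congr (_ < _).
by apply/eqP; rewrite eq_complex /= eqxx Ime eqxx.
Qed.

Lemma normc_le_ReIm (R : realType) (x y : R) : normc (x +i* y) <= `|x| + `|y|.
Proof.
have -> : x +i* y = x%:C + 'i * y%:C by simpc.
apply: le_trans (ler_normcD _ _) _; rewrite normcM !normcR.
by rewrite /= expr0n expr1n /= add0r sqrtr1 mul1r.
Qed.

Lemma cvg_ext (T : topologicalType) (u v : nat -> T) (l : T) :
  u =1 v -> u @ \oo --> l -> v @ \oo --> l.
Proof. by move=> /funext ->. Qed.

Lemma cvg_complex (R : realType) (x y : nat -> R) (a b : R) :
  x @ \oo --> a -> y @ \oo --> b ->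
  (fun n => x n +i* y n : R[i]^o) @ \oo --> (a +i* b : R[i]^o).
Proof.
move=> /cvgrPdist_lt xa /cvgrPdist_lt yb; apply/cvg_normcP => e e0.
have e20 : 0 < e / 2 by lra.
have [N1 _ h1] := xa _ e20; have [N2 _ h2] := yb _ e20.
exists (maxn N1 N2) => n; rewrite geq_max => /andP[/h1 /= {}h1 /h2 /= {}h2].
by apply: le_lt_trans (normc_le_ReIm (a - x n) (b - y n)) _; lra.
Qed.

Lemma normc_lim_le (R : realType) (u : nat -> R[i]^o) (l : R[i]^o) (B : R) :
  u @ \oo --> l -> (forall n, normc (u n) <= B) -> normc l <= B.
Proof.
move=> /cvg_normcP ul uB; apply/ler_addgt0Pr => e /ul[N /(_ N (leqnn N)) h].
have := ler_normcD (l - u N) (u N); rewrite subrK; have := uB N; lra.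
Qed.

(** A bound at every radius amounts to an infinite radius of convergence; in this form a majorant
    common to all approximants passes to their limit. *)
Definition entire (R : realType) (c : nat -> R[i]) :=
  forall rho : R, 0 < rho -> exists K, forall n, normc (c n) * rho ^+ n <= K.

Definition ev (R : realType) (c : nat -> R[i]) (z : R[i]^o) : R[i]^o :=
  lim ([series (c n * z ^+ n : R[i]^o)]_n @ \oo).

Lemma sum_half_le (R : realType) (K : R) m n : 0 <= K ->
  \sum_(m <= i < n) K / 2 ^+ i <= 2 * K / 2 ^+ m.
Proof.
move=> K0; have [nm|mn] := leqP n m.
  by rewrite big_geq // divr_ge0 ?exprn_ge0 ?mulr_ge0.
suff -> : \sum_(m <= i < n) K / 2 ^+ i = 2 * K / 2 ^+ m - 2 * K / 2 ^+ n.
  by rewrite gerBl divr_ge0 ?exprn_ge0 ?mulr_ge0.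
rewrite -opprB -(telescope_sumr (fun i => 2 * K / 2 ^+ i)) 1?ltnW // -sumrN.
apply: eq_bigr => i _; rewrite exprS; field.
by rewrite expf_eq0 pnatr_eq0 andbF.
Qed.

(** Taking the majorant at a radius at least twice the modulus of [z] makes it geometric with ratio
    1/2; the tail estimates rest on this. *)
Lemma term_le (R : realType) (c : nat -> R[i]) (z : R[i]) (rho K : R) n :
  2 * normc z <= rho -> normc (c n) * rho ^+ n <= K ->
  normc (c n * z ^+ n) <= K / 2 ^+ n.
Proof.
move=> zrho cK; rewrite normcM normcX ler_pdivlMr ?exprn_gt0 //.
apply: le_trans cK; rewrite -mulrA ler_wpM2l ?normc_ge0 // -exprMn mulrC.
by rewrite lerXn2r ?nnegrE // ?(le_trans _ zrho) ?mulr_ge0 ?normc_ge0.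
Qed.

Lemma dominant_ge0 (R : realType) (c : nat -> R[i]) (rho K : R) : 0 <= rho ->
  (forall n, normc (c n) * rho ^+ n <= K) -> 0 <= K.
Proof.
by move=> r0 /(_ 0%N); apply: le_trans; rewrite mulr_ge0 ?normc_ge0 ?exprn_ge0.
Qed.

Lemma sum_term_le (R : realType) (c : nat -> R[i]) (z : R[i]) (rho K : R) m n :
  2 * normc z <= rho -> (forall n, normc (c n) * rho ^+ n <= K) ->
  normc (\sum_(m <= i < n) c i * z ^+ i) <= 2 * K / 2 ^+ m.
Proof.
move=> zrho cK; have rho0 : 0 <= rho.
  by apply: le_trans zrho; rewrite mulr_ge0 ?normc_ge0.
apply: le_trans (ler_normc_sum _ _ _) _.
apply: le_trans (sum_half_le _ _ (dominant_ge0 rho0 cK)).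
by apply: ler_sum => i _; exact: term_le zrho (cK i).
Qed.

(** Real and imaginary parts converge absolutely by comparison with [K / 2 ^+ n], so only
    completeness of [R] enters. *)
Lemma cvg_ev (R : realType) (c : nat -> R[i]) (z : R[i]^o) : entire c ->
  [series (c n * z ^+ n : R[i]^o)]_n @ \oo --> ev c z.
Proof.
move=> ec; have z2 : 0 < 2 * normc z + 1.
  by rewrite ltr_wpDl // mulr_ge0 ?normc_ge0.
have [K cK] := ec _ z2.
have K0 := dominant_ge0 (ltW z2) cK.
have tK n : normc (c n * z ^+ n) <= K / 2 ^+ n by apply: term_le (cK n); lra.
have cvgK : cvgn (series (fun n => K / 2 ^+ n)).
  apply: nondecreasing_is_cvgn.
    apply/nondecreasing_seqP => n; rewrite /series /= big_nat_recr //= lerDl.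
    by rewrite divr_ge0 ?exprn_ge0.
  exists (2 * K) => _ [n _ <-]; have := sum_half_le 0 n K0.
  by rewrite expr0 divr1.
have cvgpart (f : R[i] -> R) : (forall w, `|f w| <= normc w) ->
    cvgn (series (fun n => f (c n * z ^+ n))).
  move=> fle; apply: normed_cvg; apply: series_le_cvg cvgK => n.
  - exact: normr_ge0.
  - by rewrite divr_ge0 ?exprn_ge0.
  - exact: le_trans (fle _) (tK n).
have Rele (w : R[i]) : `|complex.Re w| <= normc w.
  by case: w => a b /=; rewrite -sqrtr_sqr ler_wsqrtr // lerDl sqr_ge0.
have Imle (w : R[i]) : `|complex.Im w| <= normc w.
  by case: w => a b /=; rewrite -sqrtr_sqr ler_wsqrtr // lerDr sqr_ge0.
apply/cvg_ex; exists (limn (series (fun n => complex.Re (c n * z ^+ n))) +i*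
                      limn (series (fun n => complex.Im (c n * z ^+ n)))).
apply: cvg_ext (cvg_complex (cvgpart _ Rele) (cvgpart _ Imle)) => n.
rewrite /series /=.
elim: n => [|n IHn]; first by rewrite !big_geq.
by rewrite !big_nat_recr //= -IHn; case: (c n * z ^+ n).
Qed.

Lemma ev_eq (R : realType) (c : nat -> R[i]) (z l : R[i]^o) :
  [series (c n * z ^+ n : R[i]^o)]_n @ \oo --> l -> ev c z = l.
Proof. by move=> h; apply: cvg_lim => //; exact: norm_hausdorff. Qed.

Lemma ev_le (R : realType) (c : nat -> R[i]) (z : R[i]^o) (rho K : R) :
  entire c ->
  2 * normc z <= rho -> (forall n, normc (c n) * rho ^+ n <= K) ->
  normc (ev c z) <= 2 * K.
Proof.
move=> ec zrho cK; apply: normc_lim_le (cvg_ev (z := z) ec) _ => n.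
by have := sum_term_le 0 n zrho cK; rewrite expr0 divr1.
Qed.

(* [lin p q g] lists the coefficients of [(p + q X) g]. *)
Definition lin (R : realType) (p q : R[i]) (g : nat -> R[i]) (n : nat) : R[i] :=
  p * g n + (if n is m.+1 then q * g m else 0).

Definition formal_deriv (R : realType) (c : nat -> R[i]) (n : nat) : R[i] :=
  n.+1%:R * c n.+1.

Lemma entire_shift (R : realType) (c : nat -> R[i]) k : entire c ->
  entire (fun n => c (k + n)%N).
Proof.
move=> ec rho rho0; have [K cK] := ec rho rho0; exists (K / rho ^+ k) => n.
rewrite ler_pdivlMr ?exprn_gt0 // -mulrA -exprD addnC.
exact: le_trans (cK _).
Qed.

Lemma entireD (R : realType) (c d : nat -> R[i]) : entire c -> entire d ->
  entire (fun n => c n + d n).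
Proof.
move=> ec ed rho rho0; have [K cK] := ec rho rho0; have [L dL] := ed rho rho0.
exists (K + L) => n; apply: le_trans (lerD (cK n) (dL n)).
by rewrite -mulrDl ler_wpM2r ?exprn_ge0 ?(ltW rho0) ?ler_normcD.
Qed.

Lemma entireZ (R : realType) (p : R[i]) (c : nat -> R[i]) : entire c ->
  entire (fun n => p * c n).
Proof.
move=> ec rho rho0; have [K cK] := ec rho rho0.
exists (normc p * K) => n; rewrite normcM -mulrA.
by rewrite ler_wpM2l ?normc_ge0.
Qed.

Lemma entire_finite (R : realType) (c : nat -> R[i]) N :
  (forall n, (N <= n)%N -> c n = 0) -> entire c.
Proof.
move=> c0 rho rho0; exists (\sum_(i < N) normc (c i) * rho ^+ i) => n.
have t0 i : 0 <= normc (c i) * rho ^+ i.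
  by rewrite mulr_ge0 ?normc_ge0 ?exprn_ge0 ?ltW.
have [/c0 ->|nN] := leqP N n; first by rewrite normc0 mul0r sumr_ge0.
by rewrite (bigD1 (Ordinal nN)) //= lerDl sumr_ge0.
Qed.

Lemma entire_lin (R : realType) (p q : R[i]) (g : nat -> R[i]) : entire g ->
  entire (lin p q g).
Proof.
move=> eg; apply: entireD; first exact: entireZ.
move=> rho rho0; have [K gK] := eg rho rho0.
exists (normc q * (rho * K)) => -[|n].
  rewrite normc0 mul0r mulr_ge0 ?normc_ge0 // mulr_ge0 ?(ltW rho0) //.
  exact: dominant_ge0 (ltW rho0) gK.
rewrite normcM -mulrA ler_wpM2l ?normc_ge0 // exprS mulrCA.
by rewrite ler_wpM2l ?(ltW rho0).
Qed.

(** Doubling the radius absorbs the new factor, as [n.+1 <= 2 ^+ n]. *)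
Lemma entire_formal_deriv (R : realType) (c : nat -> R[i]) : entire c ->
  entire (formal_deriv c).
Proof.
move=> ec rho rho0.
have [K cK] := @entire_shift _ c 1 ec (2 * rho) (mulr_gt0 (ltr0Sn _ _) rho0).
have nle n : (n.+1%:R <= 2 ^+ n :> R) by rewrite -natrX ler_nat ltn_expl.
exists K => n; apply: le_trans (cK n).
rewrite /formal_deriv normcM exprMn add1n mulrAC mulrA mulrAC.
rewrite ler_wpM2r ?exprn_ge0 ?(ltW rho0) // mulrC ler_wpM2l ?normc_ge0 //.
have -> : n.+1%:R = (n.+1%:R : R)%:C by rewrite rmorph_nat.
by rewrite normcR ger0_norm.
Qed.

Lemma series_lin (R : realType) (p q : R[i]) (g : nat -> R[i]) (z : R[i]^o) n :
  series (fun n => lin p q g n * z ^+ n : R[i]^o) n.+1 =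
  (p + q * z) * series (fun n => g n * z ^+ n : R[i]^o) n + p * g n * z ^+ n.
Proof.
rewrite /series /=; elim: n => [|n IHn].
  by rewrite big_nat1 big_geq //= mulr0 add0r /lin addr0.
rewrite big_nat_recr //= IHn [in RHS]big_nat_recr //= /lin exprS; ring.
Qed.

Lemma term_cvg0 (R : realType) (c : nat -> R[i]) (z : R[i]^o) : entire c ->
  (fun n => c n * z ^+ n : R[i]^o) @ \oo --> (0 : R[i]^o).
Proof.
move=> ec.
have e (n : nat) : c n * z ^+ n = series (fun n => c n * z ^+ n : R[i]^o) n.+1 -
   series (fun n => c n * z ^+ n : R[i]^o) n.
  by rewrite /series /= big_nat_recr //= addrAC subrr add0r.
rewrite (funext e) -(subrr (ev c z)).
have h := cvg_ev (z := z) ec.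
by apply: cvgB => //; move: h; rewrite -cvg_shiftS.
Qed.

Lemma ev_lin (R : realType) (p q : R[i]) (g : nat -> R[i]) (z : R[i]^o) :
  entire g -> ev (lin p q g) z = (p + q * z) * ev g z.
Proof.
move=> eg; apply: ev_eq; rewrite -cvg_shiftS.
apply: cvg_ext (fun n => esym (series_lin p q g z n)) _.
under eq_fun do rewrite -mulrA.
have := cvgD (cvgM (cvg_cst (p + q * z : R[i]^o)) (cvg_ev (z := z) eg))
             (cvgM (cvg_cst (p : R[i]^o)) (term_cvg0 z eg)).
by rewrite mulr0 addr0; exact.
Qed.

Lemma evD (R : realType) (c d : nat -> R[i]) (z : R[i]^o) :
  entire c -> entire d -> ev (fun n => c n + d n) z = ev c z + ev d z.
Proof.
move=> ec ed; apply: ev_eq; apply: cvg_ext (cvgD (cvg_ev (z := z) ec) (cvg_ev (z := z) ed)) => n.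
rewrite /series /=.
by under [RHS]eq_bigr do rewrite mulrDl; rewrite big_split.
Qed.

Lemma evZ (R : realType) (p : R[i]) (c : nat -> R[i]) (z : R[i]^o) :
  entire c -> ev (fun n => p * c n) z = p * ev c z.
Proof.
move=> ec; have := ev_lin p 0 z ec; rewrite mul0r addr0 => <-.
by congr ev; apply: funext => -[|n]; rewrite /lin ?mul0r addr0.
Qed.

(* Synthetic division: [c - ev c a = (X - a) quot c a]. *)
Definition quot (R : realType) (c : nat -> R[i]) (a : R[i]) (n : nat) : R[i] :=
  ev (fun i => c (n.+1 + i)%N) a.

Lemma entire_const (R : realType) (b : R[i]) :
  entire (fun n : nat => (n == 0)%:R * b).
Proof. by apply: (@entire_finite _ _ 1) => -[|n] //; rewrite mul0r. Qed.

Lemma ev_const (R : realType) (b z : R[i]) :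
  ev (fun n : nat => (n == 0)%:R * b) z = b.
Proof.
apply: ev_eq; rewrite -cvg_shiftS; apply: cvg_ext (cvg_cst _) => n.
rewrite /series /= big_nat_recl //= mul1r expr0 mulr1 big1 ?addr0 // => i _.
by rewrite !mul0r.
Qed.

Lemma ev_recl (R : realType) (c : nat -> R[i]) (a : R[i]) : entire c ->
  ev c a = c 0%N + a * ev (fun i => c i.+1) a.
Proof.
move=> ec; have ec1 := @entire_shift _ c 1 ec.
rewrite (_ : a * _ = ev (lin 0 1 (fun i => c i.+1)) a); last first.
  by rewrite ev_lin // mul1r add0r.
rewrite -[c 0%N in RHS](ev_const _ a).
have econst := entire_const (c 0%N).
rewrite -evD //; last exact: entire_lin.
by congr ev; apply: funext => -[|n]; rewrite /lin /= !(mul1r, mul0r) ?(addr0, add0r).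
Qed.

Lemma entire_quot (R : realType) (c : nat -> R[i]) (a : R[i]) : entire c ->
  entire (quot c a).
Proof.
(* [rho <= r] and [1 <= r] give [rho ^+ n <= r ^+ n.+1]; [2 * normc a <= r] makes the series at [a]
   geometric. *)
move=> ec rho rho0; set r := Num.max rho (Num.max 1 (2 * normc a)).
have rrho : rho <= r by rewrite le_max lexx.
have r1 : 1 <= r by rewrite !le_max lexx orbT.
have r2 : 2 * normc a <= r by rewrite !le_max lexx !orbT.
have r0 : 0 < r by lra.
have [K cK] := ec r r0; exists (2 * K) => n.
have h : normc (quot c a n) <= 2 * (K / r ^+ n.+1).
  apply: (@ev_le _ _ _ r) => // [|i]; first exact: entire_shift.
  by rewrite ler_pdivlMr ?exprn_gt0 // -mulrA -exprD addnC.
have K0 := dominant_ge0 (ltW r0) cK.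
apply: le_trans (ler_wpM2r (exprn_ge0 _ (ltW rho0)) h) _.
rewrite -!mulrA ler_wpM2l // -[leRHS]mulr1 ler_wpM2l //.
rewrite mulrC ler_pdivrMr ?exprn_gt0 // mul1r exprS.
have h1 : rho ^+ n <= r ^+ n by rewrite lerXn2r ?nnegrE ?(ltW rho0) ?(ltW r0).
by rewrite (le_trans h1) // ler_peMl // exprn_ge0 // ltW.
Qed.

Lemma quotP (R : realType) (c : nat -> R[i]) (a : R[i]) : entire c ->
  c = (fun n => lin (- a) 1 (quot c a) n + (n == 0)%:R * ev c a).
Proof.
move=> ec; apply: funext => -[|n]; rewrite /lin /quot /=.
  by rewrite (ev_recl a ec) addr0 mul1r addrCA -mulrDl addNr mul0r addr0.
rewrite (ev_recl a (entire_shift n.+1 ec)) mul0r addr0 mul1r addn0.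
by under [X in ev X]eq_fun do rewrite addSnnS; rewrite addrCA -mulrDl addNr mul0r addr0.
Qed.

Lemma ev_quot (R : realType) (c : nat -> R[i]) (a z : R[i]) : entire c ->
  ev c z - ev c a = (z - a) * ev (quot c a) z.
Proof.
move=> ec; have eq := entire_quot a ec.
have econst := entire_const (ev c a).
rewrite [in X in ev X z](quotP a ec) evD //; last exact: entire_lin.
rewrite ev_lin // mul1r [- a + z]addrC.
by rewrite ev_const addrK.
Qed.

Lemma formal_deriv_lin (R : realType) (p q : R[i]) (g : nat -> R[i]) :
  formal_deriv (lin p q g) = (fun n => q * g n + lin p q (formal_deriv g) n).
Proof.
by apply: funext => -[|n]; rewrite /formal_deriv /lin; [ring | rewrite -!natr1; ring].
Qed.

(** Differentiating [c = (X - a) quot c a + ev c a] and evaluating at [a] leaves only [quot c a]. *)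
Lemma ev_formal_deriv (R : realType) (c : nat -> R[i]) (a : R[i]) : entire c ->
  ev (formal_deriv c) a = ev (quot c a) a.
Proof.
move=> ec; have eq := entire_quot a ec.
have -> : formal_deriv c = formal_deriv (lin (- a) 1 (quot c a)).
  rewrite [in LHS](quotP a ec); apply: funext => n.
  by rewrite /formal_deriv /= mul0r addr0.
rewrite formal_deriv_lin evD ?evZ ?ev_lin ?mul1r ?addNr ?mul0r ?addr0 //.
- exact: entire_formal_deriv.
- exact: entireZ.
- exact/entire_lin/entire_formal_deriv.
Qed.

(** Two synthetic divisions: the difference quotient at [a] is the value of [quot c a] at [h + a],
    and dividing once more bounds its distance from the value at [a] by [2 * K * normc h]. *)
Lemma derive1_ev (R : realType) (c : nat -> R[i]) : entire c ->
  derive1 (ev c) = ev (formal_deriv c).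
Proof.
move=> ec; apply: funext => a; rewrite ev_formal_deriv // /derive1.
have eq := entire_quot a ec; have eqq := entire_quot a eq.
apply: cvg_lim; first exact: norm_hausdorff.
have r0 : 0 < 2 * (normc a + 1) by rewrite mulr_gt0 // ltr_wpDl ?normc_ge0.
have [K hK] := eqq _ r0.
have K0 := dominant_ge0 (ltW r0) hK.
apply/cvgrPdist_lt => e; rewrite ltcE /= => /andP[/eqP Ime e0].
have eE : e = (complex.Re e)%:C by apply/eqP; rewrite eq_complex /= eqxx Ime eqxx.
pose d := Num.min 1 (complex.Re e / (2 * K + 1)).
have d0 : 0 < d by rewrite lt_min ltr01 divr_gt0 // ltr_wpDl // mulr_ge0.
near=> h.
have h0 : h != 0 by near: h; exact: (@nbhs_dnbhs_neq R[i]^o 0).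
have : `|h| < d%:C by near: h; apply: (@dnbhs0_lt _ R[i]^o); rewrite ltcR.
rewrite normcE ltcR lt_min => /andP[h1 hd].
rewrite ev_quot // addrK -[_ *: _]/(_ * _) mulKf //.
rewrite -opprB ev_quot // addrK normrN normcE eE ltcR normcM.
have : normc (ev (quot (quot c a) a) (h + a)) <= 2 * K.
  by apply: ev_le hK => //; have := ler_normcD h a; lra.
move: hd; rewrite ltr_pdivlMr ?ltr_wpDl ?mulr_ge0 // => hd le2.
apply: le_lt_trans hd; apply: ler_pM; rewrite ?normc_ge0 //; lra.
Unshelve. all: by end_near. Qed.

(** * Orders of zeros through formal derivatives *)

Lemma derive1n_ev (R : realType) (c : nat -> R[i]) k : entire c ->
  derive1n k (ev c) = ev (iter k (@formal_deriv R) c).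
Proof.
move=> ec; elim: k => [|k IHk] //; rewrite derive1nS IHk derive1_ev //.
by elim: k {IHk} => [|k IHk] //=; exact: entire_formal_deriv.
Qed.

Definition ord_ge (R : realType) (c : nat -> R[i]) (z : R[i]) (m : nat) :=
  forall k, (k < m)%N -> ev (iter k (@formal_deriv R) c) z = 0.

Lemma entire_iter_deriv (R : realType) (c : nat -> R[i]) k : entire c ->
  entire (iter k (@formal_deriv R) c).
Proof. by move=> ec; elim: k => //= k; exact: entire_formal_deriv. Qed.

(** Leibniz rule; the factor [p + q X] has degree at most one, so only two terms survive. *)
Lemma iter_deriv_lin (R : realType) (p q : R[i]) (g : nat -> R[i]) k :
  iter k.+1 (@formal_deriv R) (lin p q g) =
  (fun n => k.+1%:R * q * iter k (@formal_deriv R) g n +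
            lin p q (iter k.+1 (@formal_deriv R) g) n).
Proof.
elim: k => [|k IHk]; first by rewrite /= formal_deriv_lin mul1r.
rewrite iterS IHk; apply: funext => n.
rewrite [LHS]/formal_deriv mulrDr.
have -> : n.+1%:R * lin p q (iter k.+1 (@formal_deriv R) g) n.+1 =
    q * iter k.+1 (@formal_deriv R) g n +
    lin p q (formal_deriv (iter k.+1 (@formal_deriv R) g)) n.
  by rewrite -[LHS]/(formal_deriv (lin p q (iter k.+1 (@formal_deriv R) g)) n)
             formal_deriv_lin.
rewrite addrA; congr (_ + _).
have -> : iter k.+1 (@formal_deriv R) g n =
    n.+1%:R * iter k (@formal_deriv R) g n.+1 by [].
by rewrite -[k.+2%:R]natr1; ring.
Qed.

Lemma ev_iter_deriv_lin (R : realType) (p q : R[i]) (g : nat -> R[i]) k z :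
  entire g ->
  ev (iter k.+1 (@formal_deriv R) (lin p q g)) z =
  k.+1%:R * q * ev (iter k (@formal_deriv R) g) z +
  (p + q * z) * ev (iter k.+1 (@formal_deriv R) g) z.
Proof.
move=> eg; have ek n := entire_iter_deriv n eg.
rewrite iter_deriv_lin evD ?evZ ?ev_lin //; first exact: entireZ.
exact: entire_lin.
Qed.

(** At a root of the factor, the derivative of order [k + 1] of the product is [(k + 1) q] times
    that of order [k] of [g], so just one order is lost. *)
Lemma ord_ge_lin_root (R : realType) (p q : R[i]) (g : nat -> R[i]) z m :
  entire g -> q != 0 -> p + q * z = 0 ->
  ord_ge (lin p q g) z m -> ord_ge g z m.-1.
Proof.
move=> eg q0 z0 h k km.
have km1 : (k.+1 < m)%N by case: m km {h}.
have /eqP := h k.+1 km1; rewrite ev_iter_deriv_lin // z0 mul0r addr0.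
by rewrite !mulf_eq0 pnatr_eq0 (negPf q0) => /eqP.
Qed.

Lemma ord_ge_lin_nonroot (R : realType) (p q : R[i]) (g : nat -> R[i]) z m :
  entire g -> p + q * z != 0 -> ord_ge (lin p q g) z m -> ord_ge g z m.
Proof.
move=> eg z0 h; elim=> [|k IHk] km.
  by have /eqP := h 0%N km; rewrite /= ev_lin // mulf_eq0 (negPf z0) => /eqP.
have /eqP := h k.+1 km; rewrite ev_iter_deriv_lin // IHk; last exact: ltnW.
by rewrite mulr0 add0r mulf_eq0 (negPf z0) => /eqP.
Qed.

(** * Limits of polynomials with few zeros off the positive half-line *)

(** The lists hold reciprocals of zeros: the constant coefficient is then [a], the coefficient of
    [X] is governed by the sum of the entries, and zeros escaping to infinity are entries tending to
    0. *)
Definition fprod (R : realType) (a : R[i]) (U : seq R[i]) (T : seq R) :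
    {poly R[i]} :=
  a *: (\prod_(u <- U) (1 - u *: 'X) * \prod_(x <- T) (1 - x%:C *: 'X)).

Definition approximant (R : realType) (M : nat) (K : R -> R)
    (c : nat -> R[i]) (eps : R) (n0 : nat) (a : R[i]) (U : seq R[i]) (T : seq R) :=
  [/\ (size U <= M)%N, all (>= 0) T,
      forall rho n, 0 < rho -> normc (fprod a U T)`_n * rho ^+ n <= K rho &
      forall n, (n <= n0)%N -> normc ((fprod a U T)`_n - c n) <= eps].

(** [K] comes before [eps] and [n0]: one majorant for all approximants, with closeness of finitely
    many coefficients, gives uniform convergence on compact sets. *)
Definition real_rooted_limit (R : realType) (M : nat) (c : nat -> R[i]) :=
  exists K : R -> R, forall eps n0, 0 < eps ->
    exists a U T, approximant M K c eps n0 a U T.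

Lemma approximant_le (R : realType) M K (c : nat -> R[i]) (eps eps' : R) n0 n0'
    a U T :
  eps <= eps' -> (n0' <= n0)%N ->
  approximant M K c eps n0 a U T -> approximant M K c eps' n0' a U T.
Proof.
move=> ee nn [h1 h2 h3 h4]; split=> // n nn'.
exact: le_trans (h4 _ (leq_trans nn' nn)) ee.
Qed.

Lemma limit_dominated (R : realType) M K (c : nat -> R[i]) :
  (forall eps n0, 0 < eps -> exists a U T, approximant M K c eps n0 a U T) ->
  forall rho n, 0 < rho -> normc (c n) * rho ^+ n <= K rho.
Proof.
move=> h rho n rho0; apply/ler_addgt0Pr => e e0.
have rn : 0 < rho ^+ n by rewrite exprn_gt0.
have [a [U [T [_ _ hK hc]]]] := h (e / rho ^+ n) n (divr_gt0 e0 rn).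
apply: le_trans (lerD (hK rho n rho0) (lexx e)).
rewrite -[e in leRHS](divfK (lt0r_neq0 rn)) -mulrDl ler_wpM2r ?(ltW rn) //.
have := ler_normcD (fprod a U T)`_n (c n - (fprod a U T)`_n).
have := hc n (leqnn n); rewrite [_ + (_ - _)]addrC subrK normc_distC; lra.
Qed.

Lemma limit_entire (R : realType) M (c : nat -> R[i]) :
  real_rooted_limit M c -> entire c.
Proof.
by move=> [K h] rho rho0; exists (K rho) => n; exact: limit_dominated h _ _ rho0.
Qed.

(** * Estimates for factored polynomials *)

Lemma fprod_coef0 (R : realType) (a : R[i]) U (T : seq R) : (fprod a U T)`_0 = a.
Proof.
rewrite -horner_coef0 hornerZ hornerM !horner_prod !big1_seq ?mulr1 // => i _;
  by rewrite !hornerE /= ?mulr0 ?subr0.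
Qed.

Lemma coef1_prod (R : realType) (U : seq R[i]) :
  (\prod_(u <- U) (1 - u *: 'X))`_1 = - \sum_(u <- U) u.
Proof.
elim: U => [|u U IHU]; first by rewrite !big_nil coef1 oppr0.
have e0 : (\prod_(u <- U) (1 - u *: 'X))`_0 = 1.
  by have := fprod_coef0 1 U ([::] : seq R); rewrite /fprod big_nil mulr1 scale1r.
rewrite !big_cons mulrBl mul1r coefB IHU -scalerAl coefZ coefXM e0 mulr1.
by rewrite opprD addrC.
Qed.

Lemma prod_real_complex (R : realType) (T : seq R) :
  \prod_(x <- T) (1 - x%:C *: 'X) =
  \prod_(u <- [seq x%:C | x <- T]) (1 - u *: 'X) :> {poly R[i]}.
Proof. by rewrite big_map. Qed.

Lemma fprod_coef1 (R : realType) (a : R[i]) U (T : seq R) :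
  (fprod a U T)`_1 = - (a * (\sum_(u <- U) u + (\sum_(x <- T) x)%:C)).
Proof.
rewrite /fprod prod_real_complex -big_cat coefZ coef1_prod big_cat big_map /=.
by rewrite rmorph_sum mulrN.
Qed.

Lemma normc_ge_ReIm (R : realType) (x y : R) :
  x <= normc (x +i* y) /\ `|y| <= normc (x +i* y).
Proof.
split; last by rewrite /= -sqrtr_sqr ler_wsqrtr // lerDr sqr_ge0.
apply: le_trans (ler_norm x) _.
by rewrite /= -sqrtr_sqr ler_wsqrtr // lerDl sqr_ge0.
Qed.

(** Since [1 + k * x <= expR (k * x)], the loss over a whole list is controlled by the sum of its
    entries alone. *)
Lemma factor_lower_bound (R : realType) (z : R[i]) : ~~ (0 <= z) ->
  exists2 k : R, 0 <= k &
    forall x, 0 <= x -> 1 <= normc (1 - x%:C * z) * (1 + k * x).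
Proof.
case: z => p q hz.
have hpq : (q != 0) || ~~ (0 <= p) by move: hz; rewrite lecE negb_and.
have e x : normc (1 - x%:C * (p +i* q)) = normc ((1 - x * p) +i* (- (x * q))).
  by congr normc; simpc; rewrite /=; congr (_ +i* _);
    rewrite ?mul0r ?subr0 ?addr0 ?sub0r.
have [p0|p0] := leP p 0.
  exists 0 => // x x0.
  rewrite (_ : 1 + 0 * x = 1) ?mulr1 ?e; last by rewrite mul0r addr0.
  by apply: le_trans (normc_ge_ReIm _ _).1; nra.
have q0 : 0 < `|q|.
  by rewrite normr_gt0; apply: contraLR hpq; rewrite negbK => /eqP ->; rewrite eqxx ltW.
(* The summand [2 * p] serves [x * p <= 1/2], by [(1 - t) (1 + 2 t) >= 1] on [0, 1/2]. The other
   serves larger [x]: multiplied by [x] and by the modulus of the imaginary part, it gives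
   [4 (x p)^2 >= 1]. *)
exists (2 * p + 4 * p ^+ 2 / `|q|).
  by rewrite addr_ge0 ?divr_ge0 ?mulr_ge0 ?sqr_ge0 // ltW.
move=> x x0; rewrite e; have [h1 h2] := normc_ge_ReIm (1 - x * p) (- (x * q)).
set N := normc _ in h1 h2 *.
have kp : 0 <= 4 * p ^+ 2 / `|q| by rewrite divr_ge0 ?mulr_ge0 ?ltW.
have [xp|xp] := leP (x * p) (1 / 2).
  have xp0 : 0 <= x * p by rewrite mulr_ge0 // ltW.
  have kpx := mulr_ge0 kp x0.
  apply: (@le_trans _ _ ((1 - x * p) * (1 + 2 * (x * p)))); first by nra.
  by apply: ler_pM => //; lra.
apply: (@le_trans _ _ (`|x * q| * (4 * p ^+ 2 / `|q| * x))); last first.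
  rewrite normrN in h2; apply: ler_pM => //; [exact: mulr_ge0 | nra].
rewrite normrM (ger0_norm x0).
have -> : x * `|q| * (4 * p ^+ 2 / `|q| * x) = 4 * (x * p) ^+ 2.
  by field; rewrite gt_eqF.
nra.
Qed.

Lemma prod_lower_bound (R : realType) (z : R[i]) (k : R) (T : seq R) :
  (forall x, 0 <= x -> 1 <= normc (1 - x%:C * z) * (1 + k * x)) ->
  0 <= k -> all (>= 0) T ->
  1 <= normc (\prod_(x <- T) (1 - x%:C *: 'X)).[z] * expR (k * \sum_(x <- T) x).
Proof.
move=> h k0; elim: T => [|x T IHT].
  by rewrite !big_nil hornerC normc1 mulr0 expR0 mulr1.
move=> /= /andP[x0 /IHT {}IHT]; rewrite !big_cons hornerM normcM mulrDr expRD.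
rewrite mulrACA -[leLHS]mulr1; apply: ler_pM => //.
apply: le_trans (h x x0) _; rewrite !hornerE /= ler_wpM2l ?normc_ge0 //.
exact: expR_ge1Dx.
Qed.

(** At the zero [1/u] the higher terms cancel [a]; for [normc u > 1] their sum is at most
    [K 2 / normc u], by the majorant at radius 2. *)
Lemma root_recip_bound (R : realType) (K : R -> R) (a : R[i]) U (T : seq R) u :
  (forall rho n, 0 < rho -> normc (fprod a U T)`_n * rho ^+ n <= K rho) ->
  u \in U -> normc a * normc u <= normc a + K 2.
Proof.
move=> hK uU; have K0 : 0 <= K 2.
  by apply: le_trans (hK 2 0%N _); rewrite ?mulr_ge0 ?normc_ge0 ?exprn_ge0.
have [u1|u1] := leP (normc u) 1.
  by apply: le_trans (ler_wpM2l (normc_ge0 _) u1) _; rewrite mulr1 lerDl.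
have nu0 : 0 < normc u by lra.
have u0 : u != 0 by rewrite -normc_gt0.
have : (fprod a U T).[u^-1] = 0.
  rewrite hornerZ hornerM horner_prod (big_rem u) //= !hornerE /=.
  by rewrite mulfV // subrr !(mul0r, mulr0).
rewrite (@horner_coef_wide _ (size (fprod a U T)).+1) // big_ord_recl /=.
rewrite fprod_coef0 mulr1 => /eqP; rewrite addr_eq0 => /eqP ae.
suff : normc a <= (normc u)^-1 * K 2.
  rewrite -ler_pdivrMl ?invr_gt0 // invrK => h.
  by rewrite [normc a * _]mulrC; have := normc_ge0 a; lra.
rewrite {1}ae normcN -normcV.
under eq_bigr do rewrite exprS mulrCA.
rewrite -mulr_sumr normcM ler_wpM2l ?normc_ge0 //.
have := @sum_term_le _ (fun i => (fprod a U T)`_i.+1) u^-1 2 (K 2 / 2) 0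
  (size (fprod a U T)).
rewrite big_mkord expr0 divr1 [2 * (_ / 2)]mulrC divfK //; apply.
  have : (normc u)^-1 <= 1 by rewrite invf_le1 // ltW.
  by rewrite normcV; lra.
by move=> n; have := hK 2 n.+1 (ltr0Sn _ _); rewrite exprS mulrCA; lra.
Qed.

Lemma fprod_rem (R : realType) (a : R[i]) U (T : seq R) u : u \in U ->
  fprod a U T = (1 - u *: 'X) * fprod a (rem u U) T.
Proof.
by move=> uU; rewrite /fprod (big_rem u) //= -scalerAr -!mulrA.
Qed.

Lemma fprod_rem_coefS (R : realType) (a : R[i]) U (T : seq R) u n : u \in U ->
  (fprod a U T)`_n.+1 = (fprod a (rem u U) T)`_n.+1 - u * (fprod a (rem u U) T)`_n.
Proof.
move=> uU; rewrite (fprod_rem _ _ uU); move: (fprod _ _ _) => p.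
by rewrite mulrBl mul1r -scalerAl coefB coefZ coefXM.
Qed.

(** With [P] the product and [p] its quotient by [1 - u X], the recursion
    [p_k = (p_(k+1) - P_(k+1)) / u] runs from the top degree downwards. For [r >= 2 * W] division by
    [u r] gains the factor 1/2 that the two summands cost; running upwards would multiply by [u r]
    and lose the bound. *)
Lemma deflation_bound (R : realType) (K : R -> R) (a : R[i]) U (T : seq R) u W :
  (forall rho n, 0 < rho -> normc (fprod a U T)`_n * rho ^+ n <= K rho) ->
  u \in U -> u != 0 -> 0 <= W -> (normc u)^-1 <= W ->
  forall rho n, 0 < rho ->
    normc (fprod a (rem u U) T)`_n * rho ^+ n <= K (rho + 2 * W).
Proof.
move=> hK uU u0 W0 uW rho n rho0; set p := fprod a (rem u U) T.
(* Passing from [rho] to [rho + 2 * W] covers the radii below [2 * W]. *)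
suff h r k : 0 < r -> 2 * W <= r -> normc p`_k * r ^+ k <= K r.
  have r0 : 0 < rho + 2 * W by rewrite ltr_pwDl // mulr_ge0.
  apply: le_trans (h _ n r0 _); last by rewrite lerDr ltW.
  rewrite ler_wpM2l ?normc_ge0 // lerXn2r ?nnegrE ?(ltW rho0) ?(ltW r0) //.
  by rewrite lerDl mulr_ge0.
move=> r0 rW.
have Kr : 0 <= K r.
  by apply: le_trans (hK r 0%N r0); rewrite mulr_ge0 ?normc_ge0 ?exprn_ge0 ?ltW.
have [sk|ks] := leqP (size p) k; first by rewrite nth_default // normc0 mul0r.
have [m ->] : exists m, k = (size p - m)%N by exists (size p - k)%N; lia.
elim: m {k ks} => [|m IHm]; first by rewrite subn0 nth_default // normc0 mul0r.
have [sm|ms] := leqP (size p) m.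
  by move: IHm; rewrite (_ : size p - m.+1 = size p - m)%N //; lia.
move: IHm; rewrite -subnSK //; set k := (_ - m.+1)%N => IHk.
have -> : p`_k = u^-1 * (p`_k.+1 - (fprod a U T)`_k.+1).
  by rewrite (fprod_rem_coefS _ _ _ uU) opprB addrCA subrr addr0 mulKf.
have h1 : normc (p`_k.+1 - (fprod a U T)`_k.+1) * r ^+ k.+1 <= 2 * K r.
  apply: le_trans (ler_wpM2r (exprn_ge0 _ (ltW r0)) (ler_normcB _ _)) _.
  rewrite [leLHS]mulrDl [leRHS]mulr_natl mulr2n; apply: lerD => //.
  exact: hK.
rewrite normcM normcV.
set N := normc (_ - _) in h1 *.
have N0 : 0 <= N * r ^+ k by rewrite mulr_ge0 ?normc_ge0 ?exprn_ge0 ?ltW.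
apply: (@le_trans _ _ (W * (N * r ^+ k))); first by rewrite -mulrA ler_wpM2r.
move: N0 h1; move: N => N N0 h1 {IHk}.
move: h1; rewrite exprS mulrCA; move: (N * r ^+ k) N0 => y y0 h1.
have : 2 * W * y <= r * y by rewrite ler_wpM2r.
by rewrite -mulrA; lra.
Qed.

(* Coefficients of [c / (1 - v X)]. *)
Fixpoint deflate (R : realType) (v : R[i]) (c : nat -> R[i]) (n : nat) : R[i] :=
  if n is m.+1 then c n + v * deflate v c m else c 0%N.

Lemma deflateP (R : realType) (v : R[i]) (c : nat -> R[i]) :
  c = lin 1 (- v) (deflate v c).
Proof.
by apply: funext => -[|n]; rewrite /lin /= mul1r ?addr0 // mulNr addrK.
Qed.

(** Each coefficient of [c / (1 - v X)] is a polynomial in [v] and finitely many entries of [c],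
    hence continuous in them. *)
Lemma deflate_continuous (R : realType) (v : R[i]) (c : nat -> R[i]) n0 (eps : R) :
  0 < eps -> exists2 eta, 0 < eta &
  forall a U T u, u \in U -> normc (u - v) <= eta ->
    (forall n, (n <= n0)%N -> normc ((fprod a U T)`_n - c n) <= eta) ->
  forall n, (n <= n0)%N ->
    normc ((fprod a (rem u U) T)`_n - deflate v c n) <= eps.
Proof.
elim: n0 eps => [|n0 IHn0] eps eps0.
  exists eps => // a U T u uU _ h n; rewrite leqn0 => /eqP -> /=.
  by have := h 0%N isT; rewrite !fprod_coef0.
set B := normc v + 1; have B0 : 0 < B by rewrite ltr_wpDl ?normc_ge0.
set G := normc (deflate v c n0) + 1.
have G0 : 0 < G by rewrite ltr_wpDl ?normc_ge0.
have e1 : 0 < Num.min eps (eps / 3 / B).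
  by rewrite lt_min eps0 !divr_gt0.
have [eta eta0 h] := IHn0 _ e1.
exists (Num.min eta (Num.min 1 (Num.min (eps / 3) (eps / 3 / G)))).
  by rewrite !lt_min eta0 ltr01 !divr_gt0.
move=> a U T u uU; rewrite !le_min => /and4P[uv uv1 uv2 uv3] hP.
have hP1 n : (n <= n0.+1)%N -> normc ((fprod a U T)`_n - c n) <= eta.
  by move=> /hP; rewrite !le_min => /andP[].
have {h} h n : (n <= n0)%N ->
    normc ((fprod a (rem u U) T)`_n - deflate v c n) <= Num.min eps (eps / 3 / B).
  by apply: h => // k kn; apply: hP1; exact: leqW.
move=> n; rewrite leq_eqVlt => /orP[/eqP ->|]; last first.
  by rewrite ltnS => /h; rewrite le_min => /andP[].
have := h n0 (leqnn _); rewrite le_min => /andP[_].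
have := hP n0.+1 (leqnn _); rewrite !le_min => /and4P[_ _ hc _].
rewrite (fprod_rem_coefS _ _ _ uU) in hc; rewrite /= => hd.
set p := fprod a (rem u U) T in hc hd *.
have -> : p`_n0.+1 - (c n0.+1 + v * deflate v c n0) =
  (p`_n0.+1 - u * p`_n0 - c n0.+1) + u * (p`_n0 - deflate v c n0) +
  (u - v) * deflate v c n0 by ring.
have t1 : normc (u * (p`_n0 - deflate v c n0)) <= eps / 3.
  rewrite normcM.
  have : normc u <= B by have := ler_normcD (u - v) v; rewrite subrK /B; lra.
  move=> uB; have := ler_pM (normc_ge0 _) (normc_ge0 _) uB hd.
  by rewrite [B * _]mulrC divfK ?gt_eqF.
have t2 : normc ((u - v) * deflate v c n0) <= eps / 3.
  rewrite normcM; have dG : normc (deflate v c n0) <= G by rewrite lerDl.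
  have := ler_pM (normc_ge0 _) (normc_ge0 _) uv3 dG.
  by rewrite divfK ?gt_eqF.
apply: le_trans (ler_normcD _ _) _.
have := ler_normcD (p`_n0.+1 - u * p`_n0 - c n0.+1) (u * (p`_n0 - deflate v c n0)).
lra.
Qed.

Lemma half_pow_small (R : realType) (K e : R) : 0 <= K -> 0 < e ->
  exists N, forall n, (N <= n)%N -> K / 2 ^+ n <= e.
Proof.
move=> K0 e0; exists (Num.truncn (K / e)) => n Nn.
rewrite ler_pdivrMr ?exprn_gt0 // mulrC -ler_pdivrMr // ltW //.
apply: lt_le_trans (truncnS_gt _) _; rewrite -natrX ler_nat.
exact: leq_ltn_trans Nn (ltn_expl _ _).
Qed.

(** The value splits into a head of the difference to [c], a head of [c] and a tail of the
    approximant, each at most [d / 3]; the majorant makes the tail small uniformly. *)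
Lemma approximant_value (R : realType) M K (c : nat -> R[i]) (z : R[i]) (d : R) :
  entire c -> 0 <= K (2 * normc z + 1) -> ev c z = 0 -> 0 < d ->
  exists eps n0, 0 < eps /\ forall a U T, approximant M K c eps n0 a U T ->
    normc (fprod a U T).[z] <= d.
Proof.
move=> ec K0 cz d0; have d3 : 0 < d / 3 by rewrite divr_gt0.
set rho := 2 * normc z + 1 in K0 *.
have zrho : 2 * normc z <= rho by rewrite lerDl.
have rho0 : 0 < rho by rewrite ltr_wpDl ?mulr_ge0 ?normc_ge0.
have [N1 hN1] := half_pow_small (mulr_ge0 (ler0n _ 2) K0) d3.
have /cvg_normcP/(_ _ d3)[N2 hN2] := cvg_ev (z := z) ec; rewrite cz in hN2.
set n0 := maxn N1 N2.
set S := \sum_(0 <= i < n0) normc z ^+ i.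
have S0 : 0 <= S by apply: sumr_ge0 => i _; rewrite exprn_ge0 ?normc_ge0.
exists (d / 3 / (S + 1)), n0; split; first by rewrite divr_gt0 // ltr_wpDl.
move=> a U T [_ _ hK hc]; set p := fprod a U T in hK hc *.
rewrite (@horner_coef_wide _ (maxn n0 (size p))) ?leq_maxr //.
rewrite -(big_mkord xpredT (fun i => p`_i * z ^+ i)).
rewrite (@big_cat_nat _ _ _ n0) ?leq_maxl //=.
have t3 := @sum_term_le _ (fun i => p`_i) z rho _ n0 (maxn n0 (size p)) zrho
  (fun n => hK rho n rho0).
have h1 := hN1 n0 (leq_maxl _ _); have h2 := hN2 n0 (leq_maxr _ _).
move: h2; rewrite add0r normcN /series /= => h2.
have t1 : normc (\sum_(0 <= i < n0) (p`_i - c i) * z ^+ i) <= d / 3.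
  apply: le_trans (ler_normc_sum _ _ _) _.
  apply: (@le_trans _ _ (d / 3 / (S + 1) * S)).
    rewrite mulr_sumr big_nat [leRHS]big_nat; apply: ler_sum => i /andP[_ ilt].
    by rewrite normcM normcX ler_wpM2r ?exprn_ge0 ?normc_ge0 // hc // ltnW.
  by rewrite mulrAC ler_pdivrMr ?ltr_wpDl // ler_wpM2l ?lerDl // ltW.
have -> : \sum_(0 <= i < n0) p`_i * z ^+ i =
    \sum_(0 <= i < n0) (p`_i - c i) * z ^+ i + \sum_(0 <= i < n0) c i * z ^+ i.
  by rewrite -big_split; apply: eq_bigr => i _ /=; rewrite -mulrDl subrK.
set s1 := \sum_(0 <= i < n0) (p`_i - c i) * z ^+ i in t1 *.
set s2 := \sum_(0 <= i < n0) c i * z ^+ i in h2 *.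
set s3 := \sum_(n0 <= i < _) _ in t3 *.
have := ler_normcD (s1 + s2) s3; have := ler_normcD s1 s2.
move: (normc (s1 + s2 + s3)) (normc (s1 + s2)) (normc s1) (normc s2)
  (normc s3) t1 t3 h1 h2 => x1 x2 x3 x4 x5.
lra.
Qed.

Lemma small_factor (R : realType) (U : seq R[i]) (z : R[i]) (eta : R) M :
  0 < eta -> eta <= 1 -> (size U <= M)%N ->
  normc (\prod_(u <- U) (1 - u *: 'X)).[z] < eta ^+ M ->
  exists2 u, u \in U & normc (1 - u * z) < eta.
Proof.
move=> eta0 eta1 UM small; apply: contrapT => h; move: small; apply/negP.
rewrite -leNgt; apply: (@le_trans _ _ (eta ^+ size U)).
  by apply: ler_wiXn2l => //; exact: ltW.
have {}h u : u \in U -> eta <= normc (1 - u * z).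
  by move=> uU; rewrite leNgt; apply/negP => ?; apply: h; exists u.
elim: U h {UM} => [|u U IHU] h; first by rewrite big_nil hornerC normc1.
rewrite big_cons hornerM normcM exprS.
apply: ler_pM; rewrite ?exprn_ge0 ?(ltW eta0) //.
  by rewrite !hornerE /= h // mem_head.
by apply: IHU => v vU; rewrite h // in_cons vU orbT.
Qed.

Lemma near_root (R : realType) M K (c : nat -> R[i]) (z : R[i]) (eta eps : R) n0 :
  (forall eps n0, 0 < eps -> exists a U T, approximant M K c eps n0 a U T) ->
  c 0%N != 0 -> ev c z = 0 -> ~~ (0 <= z) -> 0 < eta -> 0 < eps ->
  exists a U T u, [/\ approximant M K c eps n0 a U T, u \in U &
    normc (1 - u * z) < eta].
Proof.
move=> h c0 cz zpos eta0 eps0.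
have Kpos rho : 0 < rho -> 0 <= K rho.
  move=> r0; apply: le_trans (limit_dominated h 0%N r0).
  by rewrite mulr_ge0 ?normc_ge0 ?exprn_ge0 // ltW.
have ec : entire c by apply: (@limit_entire _ M); exists K.
have [k k0 hk] := factor_lower_bound zpos.
set C0 := normc (c 0%N) / 2.
have C00 : 0 < C0 by rewrite divr_gt0 // normc_gt0.
(* [E] will bound the sum of [T]: the coefficient of [X] is [- a] times the total of both lists and
   has modulus at most [K 1], [normc a >= C0], and each of the at most [M] entries of [U] has
   modulus at most [1 + K 2 / C0]. *)
set E := K 1 / C0 + M%:R * (1 + K 2 / C0).
set eta1 := Num.min eta 1.
have eta10 : 0 < eta1 by rewrite lt_min eta0 ltr01.
(* Half of the lower bound that the value at [z] would obey if the product over [U] were at least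
   [eta1 ^+ M]. *)
have d0 : 0 < eta1 ^+ M * C0 * expR (- (k * E)) / 2.
  by rewrite divr_gt0 // mulr_gt0 ?expR_gt0 // mulr_gt0 // exprn_gt0.
have z1 : 0 < 2 * normc z + 1 by rewrite ltr_wpDl ?mulr_ge0 ?normc_ge0.
have [e1 [n1 [e10 small]]] := approximant_value M ec (Kpos _ z1) cz d0.
have e2 : 0 < Num.min e1 (Num.min eps C0) by rewrite !lt_min e10 eps0.
have [a [U [T ap]]] := h _ (maxn n0 n1) e2.
have ap1 : approximant M K c e1 n1 a U T.
  by apply: approximant_le ap; rewrite ?ge_min ?lexx ?leq_maxr.
have ap2 : approximant M K c eps n0 a U T.
  by apply: approximant_le ap; rewrite ?ge_min ?lexx ?orbT ?leq_maxl.
have a0 : C0 <= normc a.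
  have [_ _ _ /(_ 0%N isT)] := ap; rewrite fprod_coef0 !le_min => /and3P[_ _].
  have := ler_normcD a (c 0%N - a); rewrite addrC subrK normc_distC.
  by rewrite /C0; lra.
have na0 : 0 < normc a by apply: lt_le_trans a0.
have [UM Tpos hK _] := ap.
have sU : normc (\sum_(u <- U) u) <= M%:R * (1 + K 2 / C0).
  apply: (@le_trans _ _ ((size U)%:R * (1 + K 2 / C0))); last first.
    by rewrite ler_wpM2r ?ler_nat // addr_ge0 // divr_ge0 ?Kpos // ltW.
  apply: le_trans (ler_normc_sum _ _ _) _.
  rewrite -sum1_size natr_sum mulr_suml big_seq [leRHS]big_seq.
  apply: ler_sum => u uU; rewrite mul1r.
  have := root_recip_bound hK uU; rewrite -ler_pdivlMl // => hu.
  apply: le_trans hu _; rewrite mulrDr mulVf ?gt_eqF // lerD2l mulrC.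
  by rewrite ler_wpM2l ?Kpos // lef_pV2 ?posrE.
have sT : \sum_(x <- T) x <= E.
  have sT0 : 0 <= \sum_(x <- T) x.
    by rewrite big_seq sumr_ge0 // => x xT; exact: (allP Tpos).
  rewrite -(ger0_norm sT0) -normcR.
  have -> : (\sum_(x <- T) x)%:C = - (a^-1 * (fprod a U T)`_1) - \sum_(u <- U) u.
    by rewrite fprod_coef1 mulrN mulKf -?normc_gt0 // opprK addrC addKr.
  apply: le_trans (ler_normcB _ _) _; rewrite normcN normcM normcV lerD //.
  rewrite mulrC ler_pM ?invr_ge0 ?normc_ge0 ?lef_pV2 ?posrE //.
  by have := hK 1 1%N ltr01; rewrite expr1n mulr1.
exists a, U, T.
have [u uU hu] : exists2 u, u \in U & normc (1 - u * z) < eta1.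
  apply: (small_factor eta10 _ UM); first by rewrite ge_min lexx orbT.
  have := small _ _ _ ap1; have := prod_lower_bound hk k0 Tpos.
  rewrite /fprod hornerZ hornerM !normcM.
  set t := normc (_.[z]); set q := normc (_.[z]) => lbT hP.
  have q0 : 0 <= q by exact: normc_ge0.
  have t0 : 0 <= t by exact: normc_ge0.
  have lb : expR (- (k * E)) <= t.
    rewrite expRN -[leLHS]mul1r ler_pdivrMr ?expR_gt0 //.
    by apply: le_trans lbT _; rewrite ler_wpM2l // ler_expR ler_wpM2l.
  rewrite ltNge; apply/negP => qX.
  have h1 := ler_pM (exprn_ge0 M (ltW eta10)) (ltW C00) qX a0.
  have h2 := ler_pM (mulr_ge0 (exprn_ge0 M (ltW eta10)) (ltW C00)) (expR_ge0 _) h1 lb.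
  have e : q * normc a * t = normc a * (q * t) by ring.
  rewrite e in h2; have := le_trans h2 hP; move: d0.
  by move: (_ * expR _) => X; lra.
by exists u; split=> //; apply: lt_le_trans hu _; rewrite ge_min lexx.
Qed.

Lemma deflate_limit (R : realType) M (c : nat -> R[i]) (z : R[i]) :
  real_rooted_limit M c -> c 0%N != 0 -> ev c z = 0 -> ~~ (0 <= z) ->
  exists2 M', M = M'.+1 & real_rooted_limit M' (deflate z^-1 c).
Proof.
move=> [K h] c0 cz zpos.
have z0 : z != 0 by apply: contraNneq zpos => ->.
have nz0 : 0 < normc z by rewrite normc_gt0.
case: M h => [|M] h.
  have [a [U [T [u [[sU _ _ _] uU _]]]]] :=
    near_root 0 h c0 cz zpos ltr01 ltr01.
  by move: sU uU; rewrite leqn0 size_eq0 => /eqP ->.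
(* The choice [normc (1 - u * z) < 1/2] gives [1 / normc u <= 2 * normc z], a value of [W]
   independent of the approximant. The second requirement, [eta * normc z], comes from
   [u - 1/z = - (1 - u z) / z]. *)
exists M => //; exists (fun rho => K (rho + 2 * (2 * normc z))) => eps n0 eps0.
have [eta eta0 hd] := deflate_continuous z^-1 c n0 eps0.
have e1 : 0 < Num.min (1 / 2) (eta * normc z).
  by rewrite lt_min (mulr_gt0 eta0 nz0) divr_gt0.
have [a [U [T [u [[sU Tp hK hc] uU]]]]] := near_root n0 h c0 cz zpos e1 eta0.
rewrite lt_min => /andP[hu1 hu2]; exists a, (rem u U), T.
have uz : 1 / 2 <= normc u * normc z.
  rewrite -normcM; have := ler_normcD (1 - u * z) (u * z).
  by rewrite subrK normc1; lra.
have nu0 : 0 < normc u by rewrite -(pmulr_lgt0 _ nz0); lra.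
have u0 : u != 0 by rewrite -normc_gt0.
split=> //.
- by rewrite size_rem // -ltnS; case: (size U) sU.
- move=> rho n rho0; apply: (deflation_bound hK) => //.
    by rewrite mulr_ge0 ?normc_ge0.
  by rewrite -[leLHS]mul1r ler_pdivrMr // mulrC mulrCA; lra.
- apply: hd => //.
  have -> : u - z^-1 = - (1 - u * z) / z by field.
  by rewrite normcM normcN normcV ler_pdivrMr // ltW.
Qed.

(** * Replacing [X] by [X^2] and counting nonreal zeros *)

Definition spread (R : realType) (c : nat -> R[i]) (n : nat) : R[i] :=
  if odd n then 0 else c n./2.

(** A factor [1 - w^2 X] turns into [(1 - w X) (1 + w X)], so one deflation of [c] accounts for two
    zeros of [spread c]; this doubles the count. *)
Lemma spread_lin (R : realType) (w : R[i]) (g : nat -> R[i]) :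
  spread (lin 1 (- w ^+ 2) g) = lin 1 (- w) (lin 1 w (spread g)).
Proof.
apply: funext => -[|[|n]]; rewrite /spread /lin /= ?addr0 ?mul1r //.
  ring.
by rewrite !negbK; case: (odd n) => /=; ring.
Qed.

Lemma entire_spread (R : realType) (c : nat -> R[i]) : entire c ->
  entire (spread c).
Proof.
move=> ec rho rho0; have r2 : 0 < rho ^+ 2 by rewrite exprn_gt0.
have [K cK] := ec _ r2; exists K => n; rewrite /spread.
case: ifPn => on; first by rewrite normc0 mul0r (dominant_ge0 (ltW r2) cK).
by have := cK n./2; rewrite -exprM mul2n even_halfK.
Qed.

Lemma ev_spread (R : realType) (c : nat -> R[i]) (z : R[i]^o) : entire c ->
  ev (spread c) z = ev c (z ^+ 2).
Proof.
move=> ec; apply/esym/ev_eq.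
have /cvg_normcP h := cvg_ev (z := z) (entire_spread ec).
apply/cvg_normcP => e /h[N hN]; exists N => n Nn.
have := hN n.*2; rewrite -addnn (leq_trans Nn) ?leq_addr // addnn => /(_ isT).
congr (normc (_ - _) < _); rewrite /series /=.
elim: n {Nn} => [|n IHn]; first by rewrite !big_geq.
rewrite doubleS !big_nat_recr //= IHn /spread /= odd_double mul0r addr0.
by rewrite doubleK -exprM mul2n.
Qed.

Lemma sqr_ge0_real (R : realType) (z : R[i]) : 0 <= z ^+ 2 -> z \is Num.real.
Proof.
case: z => a b; rewrite complex_real expr2; simpc => /andP[/eqP h1 h2].
have : a * b == 0 by apply/eqP; move: h1; rewrite (mulrC b); lra.
rewrite mulf_eq0 => /orP[/eqP a0|//]; move: h2; rewrite a0 mul0r sub0r.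
by rewrite oppr_ge0 -expr2 => b2; rewrite -sqrf_eq0 eq_le b2 sqr_ge0.
Qed.

Lemma spread_nonreal_zeros (R : realType) M (c : nat -> R[i]) (s : seq R[i])
    (m : R[i] -> nat) :
  real_rooted_limit M c -> c 0%N != 0 -> uniq s ->
  {in s, forall z, z \isn't Num.real /\ ord_ge (spread c) z (m z)} ->
  (\sum_(z <- s) m z <= 2 * M)%N.
Proof.
elim: M c m => [|M IHM] c m hM c0 us hs.
all: have [/hasP[z zs mz]|/hasPn noz] := boolP (has (fun z => 0 < m z)%N s);
  last by rewrite big_seq big1 // => z /noz; rewrite lt0n negbK => /eqP.
all: have ec := limit_entire hM; have [znr /(_ 0%N mz)] := hs z zs;
  rewrite /= ev_spread // => cz.
all: have z2 : ~~ (0 <= z ^+ 2) by apply: contra znr => /sqr_ge0_real.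
(* For [M = 0] the equation [0 = M'.+1] is absurd, which closes the base case. *)
all: have [M' // [<-] {}hM] := deflate_limit hM c0 cz z2.
set g := deflate (z ^+ 2)^-1 c in hM.
have z0 : z != 0 by apply: contraNneq znr => ->; rewrite rpred0.
have eg := limit_entire hM; have esg := entire_spread eg.
have cE : spread c = lin 1 (- z^-1) (lin 1 z^-1 (spread g)).
  by rewrite -spread_lin exprVn -deflateP.
(* The list is kept and the orders at [z] and [- z] drop by one. Truncated subtraction handles an
   order that is already 0; as [s] has no duplicates, the sum drops by at most 2. *)
have {}IHM := IHM g (fun y => m y - (y == z) - (y == - z))%N hM c0 us.
have : {in s, forall y, y \isn't Num.real /\
    ord_ge (spread g) y (m y - (y == z) - (y == - z))}.
  move=> y ys; have [ynr] := hs y ys; rewrite cE => hy; split=> //.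
  have el : entire (lin 1 z^-1 (spread g)) by exact: entire_lin.
  have hz1 : ord_ge (lin 1 z^-1 (spread g)) y (m y - (y == z)).
    have [yz|yz] := eqVneq y z.
      rewrite subn1; apply: ord_ge_lin_root hy => //.
        by rewrite oppr_eq0 invr_eq0.
      by rewrite yz mulNr mulVf // subrr.
    rewrite subn0; apply: ord_ge_lin_nonroot hy => //.
    apply: contra yz; rewrite mulNr subr_eq0 eq_sym.
    by move=> /eqP/(canRL (mulVKf z0)) ->; rewrite mulr1.
  have [yz|yz] := eqVneq y (- z).
    rewrite subn1; apply: ord_ge_lin_root hz1 => //.
      by rewrite invr_eq0.
    by rewrite yz mulrN mulVf // subrr.
  rewrite subn0; apply: ord_ge_lin_nonroot hz1 => //.
  by apply: contra yz; rewrite addrC addr_eq0 => /eqP/(canRL (mulVKf z0)) ->; rewrite mulrN1.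
move=> /IHM le2M.
have cnt (x : R[i]) : (\sum_(y <- s) (y == x) <= 1)%N.
  rewrite (eq_bigr (fun y => if y == x then 1 else 0)%N); last first.
    by move=> y _; case: (y == x).
  by rewrite -big_mkcond sum1_count count_uniq_mem // leq_b1.
apply: (@leq_trans (\sum_(y <- s) ((m y - (y == z) - (y == - z)) +
  ((y == z) + (y == - z))))%N).
  by apply: leq_sum => y _; lia.
rewrite !big_split /= mulnS addnC leq_add //.
exact: (leq_add (cnt z) (cnt (- z))).
Qed.

(** A zero outside [0, oo) would make [deflate_limit] produce a predecessor of 0; the origin is
    excluded by the constant coefficient. *)
Lemma positive_zeros (R : realType) (c : nat -> R[i]) (z : R[i]) :
  real_rooted_limit 0 c -> c 0%N != 0 -> ev c z = 0 -> 0 < z.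
Proof.
move=> hM c0 cz; rewrite lt_neqAle eq_sym; apply/andP; split.
  apply: contraNneq c0 => z0; move: cz.
  by rewrite z0 (ev_recl 0 (limit_entire hM)) mul0r addr0 => ->.
apply: contrapT => /negP zpos.
by have [] := deflate_limit hM c0 cz zpos.
Qed.

Lemma ord_ge_shift (R : realType) k (c : nat -> R[i]) (z : R[i]) m :
  entire c -> (forall n, (n < k)%N -> c n = 0) -> z != 0 ->
  ord_ge c z m -> ord_ge (fun n => c (k + n)%N) z m.
Proof.
elim: k c => [|k IHk] c ec hc z0 hz; first by [].
have e1 := entire_shift 1 ec.
have cE : c = lin 0 1 (fun n => c (1 + n)%N).
  apply: funext => -[|n]; rewrite /lin mul0r ?add0r ?mul1r //.
  by rewrite hc.
have := IHk (fun n => c (1 + n)%N) e1; apply=> //.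
  by move=> n nk; rewrite hc.
move: hz; rewrite {1}cE; apply: ord_ge_lin_nonroot => //.
by rewrite add0r mul1r.
Qed.

Lemma entire_unshift (R : realType) k (c : nat -> R[i]) :
  (forall n, (n < k)%N -> c n = 0) -> entire (fun n => c (k + n)%N) -> entire c.
Proof.
elim: k c => [|k IHk] c hc ec; first by [].
have cE : c = lin 0 1 (fun n => c n.+1).
  apply: funext => -[|n]; rewrite /lin mul0r ?add0r ?mul1r //.
  by rewrite hc.
by rewrite cE; apply: entire_lin; apply: IHk => // n nk; rewrite hc.
Qed.

(** The vanishing leading coefficients contribute only a zero at the origin, which is real, so
    nonreal zeros can be counted on the shifted series. *)
Lemma nonreal_zeros_le (R : realType) M k (c : nat -> R[i]) (b : R[i]) :
  (forall n, (n < k)%N -> c n = 0) -> c k != 0 ->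
  real_rooted_limit M (fun n => c (k + n)%N) -> b != 0 ->
  at_most_nonreal_zeros (fun z => b * ev c (z ^+ 2)) (2 * M).
Proof.
move=> hc ck hM b0 s m us hs.
have ec := entire_unshift hc (limit_entire hM).
have esc := entire_spread ec.
(* The scalar [b] is treated as a linear factor without roots, so that [ord_ge_lin_nonroot] removes
   it. *)
have fE : (fun z : R[i]^o => b * ev c (z ^+ 2)) = ev (lin b 0 (spread c)).
  by apply: funext => z; rewrite (ev_lin b 0 z esc) (ev_spread z ec) (mul0r z) (addr0 b).
apply: (spread_nonreal_zeros hM) => //; first by rewrite addn0.
move=> z /hs[znr hz]; split=> //.
have z0 : z != 0 by apply: contraNneq znr => ->; rewrite rpred0.
have -> : spread (fun n => c (k + n)%N) = fun n => spread c (k.*2 + n)%N.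
  apply: funext => n; rewrite /spread oddD odd_double /=; case: ifP => // _.
  by rewrite halfD odd_double doubleK.
apply: ord_ge_shift => //.
  move=> n nk; rewrite /spread; case: ifP => // _; apply: hc.
  by rewrite ltn_half_double.
apply: (@ord_ge_lin_nonroot _ b 0) => //; first by rewrite mul0r addr0.
move=> j jm; have := hz j jm; rewrite fE derive1n_ev //.
exact: entire_lin.
Qed.

(** * Zeros of [x p' + a p] *)

(* [theta a p] is [x^(1-a) (x^a p)'], so Rolle's theorem for [x^a p] locates its zeros. *)
Definition theta (R : realType) (a : R) (p : {poly R}) : {poly R} :=
  'X * p^`() + a *: p.

Lemma coef_theta (R : realType) (a : R) (p : {poly R}) n :
  (theta a p)`_n = (n%:R + a) * p`_n.
Proof.
rewrite coefD coefZ coefXM mulrDl; congr (_ + _).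
by case: n => [|n]; rewrite ?mul0r //= coef_deriv mulr_natl.
Qed.

(** For [0 < a] the function [t^a p(t)] also vanishes at the origin, which may then serve as left
    end point although it need not be a zero of [p]. *)
Lemma rolle_theta (R : realType) (a : R) (p : {poly R}) (x y : R) :
  0 <= x -> x < y -> p.[y] = 0 -> x = 0 /\ 0 < a \/ p.[x] = 0 /\ 0 < x ->
  exists2 t, x < t < y & root (theta a p) t.
Proof.
move=> x0 xy py hx; pose f : R -> R := (fun t : R => t `^ a) * horner p.
have df (t : R) : 0 < t ->
    is_derive t (1 : R) f (t `^ a *: p^`().[t] + p.[t] *: (a * t `^ (a - 1))).
  by move=> t0; have := is_derive1_powR a t0 => ?; exact: is_deriveM.
have cont (t : R) : 0 < t -> {for t, continuous f}.
  move=> /df h; apply: differentiable_continuous; apply/derivable1_diffP.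
  exact: (@ex_derive _ _ _ _ _ _ _ h).
have y0 : 0 < y by lra.
have fx : f x = 0.
  rewrite /f /=; case: hx => [[-> a0]|[px _]]; rewrite fctE.
    by rewrite powR0 ?gt_eqF // mul0r.
  by rewrite px mulr0.
have fy : f y = 0 by rewrite /f fctE py mulr0.
have [||t ht [_ ft]] := @Rolle _ f x y xy _ _ (etrans fx (esym fy)).
- move=> t; rewrite in_itv /= => /andP[xt _].
  have t0 : 0 < t by lra.
  exact: (@ex_derive _ _ _ _ _ _ _ (df t t0)).
- apply/continuous_within_itvP => //; split.
  + by move=> t; rewrite in_itv /= => /andP[xt _]; apply: cont; lra.
  + case: hx => [[x00 a0]|[_ xpos]]; last exact/cvg_at_right_filter/cont.
    rewrite fx x00 -[X in _ --> X](mul0r p.[0]).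
    apply: (@cvgM _ _ _ _ (fun t => t `^ a) (horner p)).
      exact: powR_cvg0.
    exact/cvg_at_right_filter/continuous_horner.
  + exact/cvg_at_left_filter/cont.
exists t; first by move: ht; rewrite in_itv.
move: ht; rewrite in_itv /= => /andP[xt ty]; have t0 : 0 < t by lra.
have [_] := df t t0; rewrite ft => /esym.
rewrite -[_ *: _]/(_ * _) -[p.[t] *: _]/(_ * _).
have -> : t `^ a = t * t `^ (a - 1).
  rewrite powRB ?(gt_eqF t0) ?implybT // (powRr1 (ltW t0)).
  by rewrite mulrCA mulfV ?mulr1 // gt_eqF.
rewrite (_ : _ + _ = t `^ (a - 1) * (theta a p).[t]); last first.
  by rewrite /theta hornerD hornerM hornerX hornerZ; ring.
by move=> /eqP; rewrite mulf_eq0 gt_eqF ?powR_gt0.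
Qed.

Lemma path_ltW (R : realType) (x y : R) (T : seq R) :
  x < y -> path <%R y T -> path <%R x T.
Proof. by move=> xy; case: T => //= z T /andP[/(lt_trans xy) -> ->]. Qed.

Lemma rolle_seq (R : realType) (a : R) (p : {poly R}) (x : R) (T : seq R) :
  0 <= x -> x = 0 /\ 0 < a \/ p.[x] = 0 /\ 0 < x ->
  path <%R x T -> all (root p) T ->
  exists T', [/\ path <%R x T', size T' = size T & all (root (theta a p)) T'].
Proof.
elim: T x => [|y T IHT] x x0 hx /=; first by exists [::].
move=> /andP[xy yT] /andP[/rootP py pT].
have y0 : 0 < y by lra.
have [T' [yT' sT' rT']] := IHT y (ltW y0) (or_intror (conj py y0)) yT pT.
have [t /andP[xt ty] rt] := rolle_theta x0 xy py hx.
exists (t :: T'); rewrite /= xt sT' rt; split=> //.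
exact: path_ltW yT'.
Qed.

(** [size] is the degree plus one, so a nonzero [p] has at most [M] zeros left besides those in [T].
    The path condition makes [T] positive and free of repetitions. *)
Definition pos_rooted (R : realType) (M : nat) (p : {poly R}) :=
  exists T : seq R, [/\ path <%R 0 T, all (root p) T &
    (size p <= size T + M + 1)%N].

Lemma size_theta (R : realType) (a : R) (p : {poly R}) :
  (size (theta a p) <= size p)%N.
Proof.
by apply/leq_sizeP => j pj; rewrite coef_theta nth_default // mulr0.
Qed.

(** The degree does not grow, and each gap between consecutive zeros yields a zero. The gap from 0
    to the first one does so for [0 < a]; for [a <= 0] it is given up, which costs one in [M]. *)
Lemma pos_rooted_theta (R : realType) M (a : R) (p : {poly R}) :
  pos_rooted M p -> pos_rooted (M + (a <= 0)%R) (theta a p).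
Proof.
move=> [T [posT rT sT]]; have sp := size_theta a p.
have [a0|a0] := leP a 0.
  case: T posT rT sT => [|x T] /=.
    by exists [::]; split=> //; apply: leq_trans sp (leq_trans sT _); lia.
  move=> /andP[x0 xT] /andP[/rootP px rT] sT.
  have [T' [xT' sT' rT']] := @rolle_seq _ a p x T (ltW x0) (or_intror (conj px x0)) xT rT.
  exists T'; split=> //; last by apply: leq_trans sp (leq_trans sT _); rewrite sT'; lia.
  exact: path_ltW xT'.
have [T' [xT' sT' rT']] := @rolle_seq _ a p 0 T (lexx 0) (or_introl (conj erefl a0)) posT rT.
by exists T'; split=> //; apply: leq_trans sp (leq_trans sT _); rewrite sT'; lia.
Qed.

Lemma pos_rooted_iter_theta (R : realType) M (a : nat -> R) (p : {poly R}) N :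
  pos_rooted M p ->
  pos_rooted (M + \sum_(k < N) (a k <= 0)%R) (iteri N (fun k => theta (a k)) p).
Proof.
move=> hp; elim: N => [|N IHN]; first by rewrite big_ord0 addn0.
by rewrite big_ord_recr /= addnA; exact: pos_rooted_theta.
Qed.

Lemma coef_iter_theta (R : realType) (a : nat -> R) (p : {poly R}) N n :
  (iteri N (fun k => theta (a k)) p)`_n = \prod_(k < N) (n%:R + a k) * p`_n.
Proof.
elim: N => [|N IHN]; first by rewrite big_ord0 mul1r.
by rewrite big_ord_recr /= coef_theta IHN mulrA [X in X * _]mulrC.
Qed.

Lemma prod_recip (F : fieldType) (r : seq F) : 0 \notin r ->
  exists b : F, \prod_(z <- r) ('X - z%:P) =
                b *: \prod_(u <- [seq z^-1 | z <- r]) (1 - u *: 'X).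
Proof.
elim: r => [|z r IHr]; first by exists 1; rewrite /= !big_nil scale1r.
rewrite in_cons negb_or eq_sym => /andP[z0 /IHr[b e]].
have zE : 'X - z%:P = - z *: (1 - z^-1 *: 'X) :> {poly F}.
  by rewrite scalerBr scalerA mulNr mulfV // !scaleNr scale1r opprK addrC alg_polyC.
exists (- z * b); rewrite /= !big_cons e zE -scalerAl -scalerAr scalerA.
by [].
Qed.

(** After division by the factors of [T] the cofactor has degree at most [M] and splits over [R[i]];
    the nonzero constant coefficient makes all zeros invertible. *)
Lemma pos_rooted_fprod (R : realType) M (p : {poly R}) :
  pos_rooted M p -> p`_0 != 0 ->
  exists a U T, [/\ (size U <= M)%N, all (>= 0) T &
    map_poly (real_complex R) p = fprod a U T].
Proof.
move=> [T [posT rT sT]] p0.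
have p_neq0 : p != 0 by apply: contraNneq p0 => ->; rewrite coef0.
have uT : uniq T by move: (path_sorted posT); exact: lt_sorted_uniq.
have /allP Tgt0 := order_path_min lt_trans posT.
have [q pE] := uniq_roots_prod_XsubC rT (introT idP (etrans (uniq_rootsE T) uT)).
have q0 : q != 0 by apply: contraNneq p_neq0 => q0; rewrite pE q0 mul0r.
have sq : (size q <= M.+1)%N.
  move: sT; rewrite pE size_Mmonic ?monic_prod_XsubC // size_prod_XsubC.
  by rewrite addnS /= -addnA [(size T + _)%N]addnC leq_add2r addn1.
have [r qE] := closed_field_poly_normal (map_poly (real_complex R) q).
have lq0 : lead_coef (map_poly (real_complex R) q) != 0.
  by rewrite lead_coef_eq0 map_poly_eq0.
have sr : (size r <= M)%N.
  have : size (map_poly (real_complex R) q) = (size r).+1.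
    by rewrite qE size_scale // size_prod_XsubC.
  by rewrite size_map_poly => e; rewrite e in sq.
have r0 : 0 \notin r.
  apply: contra p0 => r0; rewrite -horner_coef0 pE hornerM.
  have : (map_poly (real_complex R) q).[0] == 0.
    by rewrite qE hornerZ; have /rootP -> : root (\prod_(z <- r) ('X - z%:P)) 0;
      rewrite ?root_prod_XsubC ?mulr0.
  rewrite -(rmorph0 (real_complex R)) horner_map fmorph_eq0 => /eqP ->.
  by rewrite mul0r.
have T0 : 0 \notin [seq x%:C | x <- T].
  apply/mapP => -[x /Tgt0 xpos /complexI x0].
  by move: xpos; rewrite -x0 ltxx.
have [b bE] := prod_recip r0; have [d dE] := prod_recip T0.
exists (lead_coef (map_poly (real_complex R) q) * (b * d)).
exists [seq z^-1 | z <- r], [seq x^-1 | x <- T]; split.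
- by rewrite size_map.
- by apply/allP => _ /mapP[x /Tgt0 xpos ->]; rewrite invr_ge0 ltW.
rewrite pE rmorphM /= rmorph_prod {1}qE bE.
have -> : \prod_(z <- T) map_poly (real_complex R) ('X - z%:P) =
    \prod_(z <- [seq x%:C | x <- T]) ('X - z%:P).
  by rewrite big_map; apply: eq_bigr => x _; rewrite rmorphB /= map_polyX map_polyC.
rewrite dE /fprod prod_real_complex -!map_comp.
have -> : [seq (real_complex R \o GRing.inv) x | x <- T] =
          [seq (GRing.inv \o real_complex R) x | x <- T].
  by apply: eq_map => x /=; rewrite fmorphV.
by rewrite -!scalerAl -!scalerAr !scalerA -mulrA.
Qed.

Lemma pos_rooted_drop (R : realType) M k (p : {poly R}) :
  pos_rooted M p -> (forall n, (n < k)%N -> p`_n = 0) ->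
  pos_rooted M (drop_poly k p).
Proof.
move=> [T [posT rT sT]] pk; exists T; split=> //; last first.
  by apply: leq_trans sT; rewrite size_drop_poly leq_subr.
apply/allP => x xT; have := allP rT x xT.
have xpos : 0 < x by exact: (allP (order_path_min lt_trans posT)).
rewrite -{1}(poly_take_drop k p) (_ : take_poly k p = 0) ?add0r.
  by rewrite rootM => /orP[//|]; rewrite rootE hornerXn expf_eq0 gt_eqF // andbF.
apply/polyP => n; rewrite coef_take_poly coef0; case: ifP => // nk; exact: pk.
Qed.

(** * The start polynomials *)

(** Up to sign the coefficient is an elementary symmetric function of [us]; the induction follows
    Pascal's rule. *)
Lemma coef_prod_bounds (R : realType) (us : seq R) (l h : R) n :
  0 <= l -> (forall u, u \in us -> l <= u <= h) ->
  'C(size us, n)%:R * l ^+ n <=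
    (-1) ^+ n * (\prod_(u <- us) (1 - u *: 'X))`_n <=
  'C(size us, n)%:R * h ^+ n.
Proof.
move=> l0; elim: us n => [|u us IHus] n hu.
  rewrite big_nil coef1; case: n => [|n]; rewrite /= ?bin0 ?expr0 ?mulr1 ?lexx //.
  by rewrite bin0n mulr0 !mul0r lexx.
have /andP[lu uh] := hu u (mem_head _ _).
have {}IHus k := IHus k (fun v vs => hu v (mem_behead (s := u :: us) vs)).
have u0 : 0 <= u by lra.
rewrite big_cons mulrBl mul1r -scalerAl coefB coefZ coefXM.
case: n => [|n] /=.
  by rewrite mulr0 subr0; have := IHus 0%N; rewrite !bin0.
set p := \prod_(v <- us) _ in IHus *.
have -> : (-1) ^+ n.+1 * (p`_n.+1 - u * p`_n) =
  (-1) ^+ n.+1 * p`_n.+1 + u * ((-1) ^+ n * p`_n) by rewrite exprS; ring.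
have /andP[h1 h2] := IHus n.+1; have /andP[h3 h4] := IHus n.
rewrite binS natrD !mulrDl; apply/andP; split; apply: lerD => //; rewrite exprS.
  by rewrite mulrCA ler_pM // mulr_ge0 ?exprn_ge0.
rewrite [leRHS]mulrCA ler_pM //.
by apply: le_trans h3; rewrite mulr_ge0 ?exprn_ge0.
Qed.

(* Distinct approximations of [s / N.+1], so that the start polynomial has simple zeros. *)
Definition start_recip (R : realType) (s : R) (N k : nat) : R :=
  s / N.+1%:R * (1 + (N.+1 * k.+1)%:R^-1).

(** A perturbed [(1 - s X / (N + 1))^N]: its coefficients divided by [s ^+ n] tend to those of
    exp(-X). *)
Definition start_poly (R : realType) (s : R) (N : nat) : {poly R} :=
  \prod_(u <- [seq start_recip s N k | k <- iota 0 N]) (1 - u *: 'X).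

Lemma start_recip_gt0 (R : realType) (s : R) N k : 0 < s -> 0 < start_recip s N k.
Proof.
by move=> s0; rewrite mulr_gt0 ?divr_gt0 // ltr_pwDl // invr_ge0.
Qed.

Lemma start_pos_rooted (R : realType) (s : R) N : 0 < s ->
  pos_rooted 0 (start_poly s N).
Proof.
move=> s0; exists [seq (start_recip s N k)^-1 | k <- iota 0 N]; split.
- rewrite path_sortedE; last exact: lt_trans.
  apply/andP; split.
    by apply/allP => _ /mapP[k _ ->]; rewrite invr_gt0 start_recip_gt0.
  apply: (@homo_sorted _ _ _ ltn); last exact: iota_ltn_sorted.
  move=> i j ij; rewrite ltf_pV2 ?posrE ?start_recip_gt0 //.
  rewrite /start_recip ltr_pM2l ?divr_gt0 // ltrD2l ltf_pV2 ?posrE ?ltr0n //.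
  by rewrite ltr_nat ltn_pmul2l.
- apply/allP => _ /mapP[k kN ->]; rewrite /start_poly rootE horner_prod.
  rewrite (big_rem (start_recip s N k)) /=; last exact: map_f.
  by rewrite !hornerE /= mulfV ?subrr ?mul0r // gt_eqF // start_recip_gt0.
- rewrite size_map addn0 addn1 /start_poly.
  elim: (iota 0 N) => [|k t IHt]; first by rewrite big_nil size_poly1.
  rewrite /= big_cons; apply: leq_trans (size_polyMleq _ _) _.
  have : (size (1 - start_recip s N k *: 'X : {poly R})%R <= 2)%N.
    rewrite (leq_trans (size_polyD _ _)) // geq_max size_poly1 size_polyN.
    by rewrite (leq_trans (size_scale_leq _ _)) // size_polyX.
  move: (size _) (size _) IHt => a b; lia.
Qed.

Lemma start_coef_bounds (R : realType) (s : R) N n : 0 < s ->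
  'C(N, n)%:R / N.+1%:R ^+ n <=
    (-1) ^+ n * ((start_poly s N)`_n / s ^+ n) <=
  'C(N, n)%:R / N.+1%:R ^+ n * (1 + N.+1%:R^-1) ^+ n.
Proof.
move=> s0; have sn : 0 < s ^+ n by rewrite exprn_gt0.
have l0 : 0 <= s / N.+1%:R by rewrite divr_ge0 ?ltW.
have hu u : u \in [seq start_recip s N k | k <- iota 0 N] ->
    s / N.+1%:R <= u <= s / N.+1%:R * (1 + N.+1%:R^-1).
  move=> /mapP[k _ ->]; rewrite /start_recip.
  rewrite -[X in X <= _ <= _]mulr1 !ler_wpM2l ?lerDl ?lerD2l ?invr_ge0 //=.
  by rewrite lef_pV2 ?posrE ?ltr0n // ler_nat leq_pmulr.
have := coef_prod_bounds n l0 hu; rewrite size_map size_iota -/(start_poly s N).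
move=> /andP[h1 h2]; rewrite mulrA; apply/andP; split.
  rewrite ler_pdivlMr //; apply: le_trans h1.
  by rewrite expr_div_n mulrA mulrAC lexx.
rewrite ler_pdivrMr //; apply: le_trans h2 _.
by rewrite exprMn expr_div_n le_eqVlt; apply/orP; left; apply/eqP; ring.
Qed.

Lemma bin_div_le (R : realType) N n :
  'C(N, n)%:R / N.+1%:R ^+ n <= (n`!%:R)^-1 :> R.
Proof.
rewrite ler_pdivrMr ?exprn_gt0 // ler_pdivlMl ?ltr0n ?fact_gt0 //.
rewrite -natrX -natrM ler_nat mulnC bin_ffact.
elim: n => // n IHn; rewrite ffactnSr expnSr leq_mul //.
by rewrite (leq_trans (leq_subr _ _)).
Qed.

Lemma start_coef_le (R : realType) (s : R) N n : 0 < s ->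
  `|(start_poly s N)`_n / s ^+ n| <= 2 ^+ n / n`!%:R.
Proof.
move=> s0; have /andP[h1 h2] := start_coef_bounds N n s0.
have c0 : 0 <= 'C(N, n)%:R / N.+1%:R ^+ n :> R by rewrite divr_ge0 ?exprn_ge0.
have -> : `|(start_poly s N)`_n / s ^+ n| =
    (-1) ^+ n * ((start_poly s N)`_n / s ^+ n).
  by rewrite -[RHS]ger0_norm ?(le_trans c0) // [RHS]normrM normrX normrN1 expr1n mul1r.
apply: le_trans h2 _; rewrite mulrC; apply: ler_pM => //.
- rewrite lerXn2r ?nnegrE ?addr_ge0 ?invr_ge0 //.
  by rewrite -[leRHS]/(1 + 1) lerD2l invf_le1 ?ltr0n // ler1n.
- exact: bin_div_le.
Qed.

(** A squeeze between bounds free of [s], so the scale may vary with [N], as it does in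
    [gamma_approx]. *)
Lemma start_coef_cvg (R : realType) (s : nat -> R) n : (forall N, 0 < s N) ->
  (fun N => (start_poly (s N) N)`_n / s N ^+ n) @ \oo -->
  ((-1) ^+ n / n`!%:R : R).
Proof.
move=> s0.
have inv0 : (fun N => N.+1%:R^-1 : R) @ \oo --> (0 : R) by exact: cvg_harmonic.
have binc k : (fun N => 'C(N, k)%:R / N.+1%:R ^+ k : R) @ \oo --> (k`!%:R^-1 : R).
  elim: k => [|k IHk].
    apply: cvg_ext (cvg_cst _) => N /=.
    by rewrite bin0 expr0 ?fact0 divr1 invr1.
  have sub1 : (fun N => (N - k)%:R / N.+1%:R : R) @ \oo --> (1 : R).
    have h1 : (fun N => 1 - k.+1%:R * N.+1%:R^-1 : R) @ \oo --> (1 - k.+1%:R * 0 : R).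
      apply: cvgB; first exact: cvg_cst.
      by apply: cvgM => //; exact: cvg_cst.
    rewrite mulr0 subr0 in h1; apply: cvg_trans h1; apply: near_eq_cvg.
    near=> N; have kN : (k <= N)%N by near: N; exists k.
    rewrite /= natrB // -[N.+1%:R]natr1 -[k.+1%:R]natr1; field.
    by rewrite natr1 pnatr_eq0.
  rewrite factS natrM invfM mulrC -[k`!%:R^-1]mulr1.
  apply: cvg_ext (cvgM (cvgM IHk sub1) (cvg_cst (k.+1%:R^-1 : R))) => N /=.
  have := mul_bin_left N k => /(congr1 (fun i => i%:R : R)).
  rewrite !natrM => e; rewrite exprS invfM -mulrA mulrACA -mulrA.
  apply: (@mulfI _ k.+1%:R); first by rewrite pnatr_eq0.
  rewrite [RHS]mulrA e; field.
  by rewrite expf_eq0 !nat1r !pnatr_eq0 andbF.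
have up : (fun N => 'C(N, n)%:R / N.+1%:R ^+ n * (1 + N.+1%:R^-1) ^+ n : R) @ \oo
    --> (n`!%:R^-1 : R).
  have -> : n`!%:R^-1 = n`!%:R^-1 * (1 + 0) ^+ n :> R.
    by rewrite addr0 expr1n mulr1.
  apply: cvgM; first exact: binc.
  have : (fun N => 1 + N.+1%:R^-1 : R) @ \oo --> (1 + 0 : R).
    by apply: cvgD => //; exact: cvg_cst.
  elim: n => [|k IHk] h.
    by apply: cvg_ext (cvg_cst _) => N /=; rewrite !expr0.
  rewrite exprS; apply: cvg_ext (cvgM h (IHk h)) => N /=.
  by rewrite exprS.
have sq : (fun N => (-1) ^+ n * ((start_poly (s N) N)`_n / s N ^+ n)) @ \oo
    --> (n`!%:R^-1 : R).
  apply: (squeeze_cvgr _ (binc n) up); near=> N; exact: start_coef_bounds.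
apply: cvg_ext (cvgM (cvg_cst ((-1) ^+ n : R)) sq) => N /=.
by rewrite mulrA -exprD addnn -mul2n exprM sqrrN !expr1n mul1r.
Unshelve. all: by end_near. Qed.

(** * The reciprocal gamma function *)

Definition gauss_prod (R : realType) (x : R) (n : nat) : R :=
  (\prod_(k < n.+1) (x + k%:R)) / (n`!%:R * n%:R `^ x).

Lemma rGammaE (R : realType) (x : R) : rGamma x = limn (gauss_prod x).
Proof. by []. Qed.

(** Finite form of [1/Gamma(x) = x / Gamma(x + 1)]; the index [n.+1] keeps the base of the power
    nonzero. *)
Lemma gauss_prod_rec (R : realType) (x : R) n :
  x * n.+1%:R * gauss_prod (x + 1) n.+1 = (x + n.+2%:R) * gauss_prod x n.+1.
Proof.
rewrite /gauss_prod powRD ?powRr1 //; last by rewrite pnatr_eq0 implybT.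
have -> : \prod_(k < n.+2) (x + 1 + k%:R) = \prod_(k < n.+2) (x + k.+1%:R).
  by apply: eq_bigr => k _; rewrite -nat1r addrA.
have e : x * \prod_(k < n.+2) (x + k.+1%:R) = (x + n.+2%:R) * \prod_(k < n.+2) (x + k%:R).
  have := @big_ord_recl R 1 *%R n.+2 (fun k => x + k%:R).
  by rewrite addr0 => <-; rewrite big_ord_recr /= mulrC.
rewrite [x * _]mulrC -mulrA [x * (_ / _)]mulrA e; field.
by rewrite powR_eq0 !pnatr_eq0 -lt0n fact_gt0 nat1r pnatr_eq0.
Qed.

Lemma gauss_prod_ge0 (R : realType) (x : R) n : 0 <= x -> 0 <= gauss_prod x n.
Proof.
move=> x0; rewrite divr_ge0 ?mulr_ge0 ?powR_ge0 // prodr_ge0 // => k _.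
by rewrite addr_ge0.
Qed.

Lemma gauss_prodS (R : realType) (x : R) n :
  gauss_prod x n.+2 =
  gauss_prod x n.+1 * ((1 + x / n.+2%:R) * (n.+1%:R / n.+2%:R) `^ x).
Proof.
have q0 : 0 < n.+1%:R / n.+2%:R :> R by rewrite divr_gt0.
have nE : n.+1%:R `^ x = (n.+1%:R / n.+2%:R) `^ x * n.+2%:R `^ x.
  by rewrite -powRM ?ltW // divfK // pnatr_eq0.
rewrite /gauss_prod [in LHS]big_ord_recr /= nE factS natrM.
have := powR_gt0 x q0; set q := _ `^ x => qx0.
have := powR_gt0 x (ltr0Sn R n.+1); set r := n.+2%:R `^ x => r0.
have := ltr0Sn R n.+1; set t : R := n.+2%:R => t0.
have : 0 < n.+1`!%:R :> R by rewrite ltr0n fact_gt0.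
set u := n.+1`!%:R => u0; move: (\prod_(k < _) _) => p.
field; by rewrite !gt_eqF.
Qed.

(** With [m = n + 2] the ratio of the two terms is [(1 + x/m) (1 - 1/m)^x], at most
    [exp(x/m) exp(-x/m) = 1]. *)
Lemma gauss_prod_nonincr (R : realType) (x : R) n : 0 <= x ->
  gauss_prod x n.+2 <= gauss_prod x n.+1.
Proof.
move=> x0; rewrite gauss_prodS -[leRHS]mulr1 ler_wpM2l ?gauss_prod_ge0 //.
have n0 : 0 < n.+2%:R :> R by [].
have -> : n.+1%:R / n.+2%:R = 1 + - n.+2%:R^-1 :> R.
  by rewrite -[n.+2%:R]natr1; field; rewrite ?nat1r ?natr1 pnatr_eq0.
apply: (@le_trans _ _ (expR (x / n.+2%:R) * expR (x * - n.+2%:R^-1))).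
  apply: ler_pM; rewrite ?powR_ge0 ?expR_ge1Dx //.
    by rewrite addr_ge0 // divr_ge0.
  have inv1 : n.+2%:R^-1 < 1 :> R by rewrite invf_lt1 // ltr1n.
  have q0 : 0 < 1 + - n.+2%:R^-1 :> R by rewrite subr_gt0.
  rewrite /powR (gt_eqF q0).
  by rewrite ler_expR ler_wpM2l // le_ln1Dx // ltrN2.
by rewrite -expRD mulrN subrr expR0.
Qed.

(** Young's inequality for the product of [(1 + h)^x] and 1, with conjugate exponents [1/x] and
    [1/(1 - x)]. *)
Lemma bernoulli_le1 (R : realType) (x h : R) : 0 <= x <= 1 -> 0 <= h ->
  (1 + h) `^ x <= 1 + x * h.
Proof.
move=> /andP[x0 x1] h0.
move: x0; rewrite le_eqVlt => /predU1P[<-|x0].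
  by rewrite powRr0 mul0r addr0.
move: x1; rewrite le_eqVlt => /predU1P[->|x1].
  by rewrite powRr1 ?mul1r // addr_ge0.
have h1 : 0 <= 1 + h by rewrite addr_ge0.
have := @conjugate_powR _ ((1 + h) `^ x) 1 x^-1 (1 - x)^-1.
rewrite powR_ge0 !invr_gt0 x0 subr_gt0 x1 !invrK addrC subrK -powRrM mulfV ?gt_eqF //.
rewrite powRr1 // powR1 mulr1 mul1r.
move=> /(_ isT ler01 isT isT erefl); lra.
Qed.

(** This bound survives the limit and makes 1/Gamma positive on (0, 1]. It follows by writing
    [(n + 2)^x] as a product of powers [(1 + 1/i)^x] and applying Bernoulli's inequality to each. *)
Lemma gauss_prod_ge (R : realType) (x : R) n : 0 <= x <= 1 ->
  x <= gauss_prod x n.+1.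
Proof.
move=> hx; have /andP[x0 x1] := hx.
have h k : k.+2%:R `^ x <= \prod_(i < k.+1) (1 + x / i.+1%:R).
  elim: k => [|k IHk].
    rewrite big_ord1 divr1; have := bernoulli_le1 hx ler01.
    by rewrite mulr1.
  rewrite big_ord_recr /=.
  have -> : k.+3%:R = k.+2%:R * (1 + k.+2%:R^-1) :> R.
    by rewrite mulrDr mulr1 mulfV ?pnatr_eq0 // natr1.
  have w0 : 0 <= 1 + k.+2%:R^-1 :> R by rewrite addr_ge0.
  rewrite powRM //; apply: ler_pM; rewrite ?powR_ge0 //.
  by apply: bernoulli_le1; rewrite ?invr_ge0.
rewrite /gauss_prod ler_pdivlMr ?mulr_gt0 ?ltr0n ?fact_gt0 ?powR_gt0 //.
rewrite big_ord_recl /= addr0 ler_wpM2l //.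
have -> : \prod_(i < n.+1) (x + (lift ord0 i)%:R) =
    n.+1`!%:R * \prod_(i < n.+1) (1 + x / i.+1%:R).
  rewrite fact_prod big_add1 /= big_mkord natr_prod -big_split /=.
  by apply: eq_bigr => i _; rewrite mulrDr mulr1 mulrCA mulfV ?mulr1 ?pnatr_eq0 // addrC.
rewrite ler_wpM2l //; apply: le_trans (h n).
by rewrite ge0_ler_powR ?nnegrE // ler_nat.
Qed.

(** Transports facts about 1/Gamma from [1 <= x] to the whole line along the functional equation. *)
Lemma shift_pos_ind (R : realType) (P : R -> Prop) :
  (forall x, 1 <= x -> P x) -> (forall x, P (x + 1) -> P x) -> forall x, P x.
Proof.
move=> P1 PS x.
suff h n : forall y, 1 <= y + n%:R -> P y.
  apply: (h (Num.truncn `|x|).+2); rewrite -natr1.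
  have := truncnS_gt `|x|; have := ler_norm (- x); rewrite normrN; lra.
elim: n => [|n IHn] y hy; first by apply: P1; move: hy; rewrite addr0.
by apply: PS; apply: IHn; rewrite -addrA nat1r.
Qed.

Lemma gauss_prod_down (R : realType) (x l : R) :
  gauss_prod (x + 1) @ \oo --> l -> gauss_prod x @ \oo --> x * l.
Proof.
move=> h; rewrite -cvg_shiftS.
have inv0 : (fun N => N.+1%:R^-1 : R) @ \oo --> (0 : R) by exact: cvg_harmonic.
have d1 : (fun n => 1 + (x + 1) * n.+1%:R^-1 : R) @ \oo --> (1 + (x + 1) * 0 : R).
  apply: cvgD; first exact: cvg_cst.
  by apply: cvgM => //; exact: cvg_cst.
rewrite mulr0 addr0 in d1; have {}d1 := cvgV (oner_neq0 R) d1.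
have h1 : (fun n => x * gauss_prod (x + 1) n.+1 * (1 + (x + 1) * n.+1%:R^-1)^-1 : R)
    @ \oo --> (x * l * 1^-1 : R).
  have h' : (fun n => gauss_prod (x + 1) n.+1) @ \oo --> l by rewrite cvg_shiftS.
  by apply: cvg_ext (cvgM (cvgM (cvg_cst (x : R)) h') (d1 _)).
rewrite invr1 mulr1 in h1; apply: cvg_trans h1; apply: near_eq_cvg.
near=> n; have := gauss_prod_rec x n.
have xn : 0 < x + n.+2%:R.
  near: n; exists (Num.truncn `|x|) => // n /= xn.
  have := truncnS_gt `|x|; have := ler_norm (- x); rewrite normrN.
  have : (Num.truncn `|x|).+1%:R <= n.+1%:R :> R by rewrite ler_nat.
  by rewrite -[n.+2%:R]natr1; lra.
have n0 : 0 < n.+1%:R :> R by [].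
have -> : 1 + (x + 1) * n.+1%:R^-1 = (x + n.+2%:R) / n.+1%:R.
  by rewrite -[n.+2%:R]natr1; field; rewrite gt_eqF.
move=> e; rewrite invf_div mulrA; apply/(canLR (mulfK (lt0r_neq0 xn))).
by rewrite [RHS]mulrC -e; ring.
Unshelve. all: by end_near. Qed.

Lemma is_cvg_gauss_prod (R : realType) (x : R) : cvgn (gauss_prod x).
Proof.
move: x; apply: shift_pos_ind => x; last first.
  by move=> /cvg_ex[l hl]; apply/cvg_ex; exists (x * l); exact: gauss_prod_down.
move=> x1; have x0 : 0 <= x by lra.
have : cvgn (fun n => gauss_prod x n.+1).
  apply: nonincreasing_is_cvgn.
    by apply/nonincreasing_seqP => n; exact: gauss_prod_nonincr.
  by exists 0 => _ [n _ <-]; exact: gauss_prod_ge0.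
by move=> /cvg_ex[l hl]; apply/cvg_ex; exists l; rewrite -cvg_shiftS.
Qed.

Lemma cvg_gauss_prod (R : realType) (x : R) : gauss_prod x @ \oo --> rGamma x.
Proof. exact: is_cvg_gauss_prod. Qed.

Lemma rGamma_rec (R : realType) (x : R) : rGamma x = x * rGamma (x + 1).
Proof.
rewrite [LHS]rGammaE; apply: cvg_lim; first exact: norm_hausdorff.
exact/gauss_prod_down/cvg_gauss_prod.
Qed.

Lemma rGamma_gt0 (R : realType) (x : R) : 0 < x -> 0 < rGamma x.
Proof.
move=> x0; have [n xn] : exists n, x <= n.+1%:R.
  by exists (Num.truncn x); rewrite ltW // truncnS_gt.
elim: n x x0 xn => [|n IHn] x x0 xn.
  apply: (lt_le_trans x0); rewrite rGammaE.
  apply: limr_ge; first exact: is_cvg_gauss_prod.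
  near=> N; have N0 : (0 < N)%N by near: N; exists 1%N.
  by rewrite -(prednK N0) gauss_prod_ge // ltW.
have [x1|x1] := ltP 1 x; last first.
  by apply: IHn => //; apply: le_trans x1 _; rewrite ler1n.
have : 0 < rGamma (x - 1).
  by apply: IHn; [rewrite subr_gt0 | rewrite lerBlDr natr1].
by rewrite rGamma_rec subrK pmulr_rgt0 // subr_gt0.
Unshelve. all: by end_near. Qed.

Lemma rGamma_neq0 (R : realType) (x : R) : (forall k : nat, x + k%:R != 0) ->
  rGamma x != 0.
Proof.
move: x; apply: shift_pos_ind => [x x1 _|x IHx xk].
  by rewrite gt_eqF // rGamma_gt0 //; lra.
rewrite rGamma_rec mulf_neq0 //; first by have := xk 0%N; rewrite addr0.
by apply: IHx => k; rewrite -addrA nat1r.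
Qed.

Lemma rGamma_eq0 (R : realType) (x : R) (k : nat) : x + k%:R = 0 -> rGamma x = 0.
Proof.
elim: k x => [|k IHk] x; first by rewrite addr0 rGamma_rec => ->; rewrite mul0r.
by move=> xk; rewrite rGamma_rec IHk ?mulr0 // -addrA nat1r.
Qed.

Lemma gauss_prod_eq0 (R : realType) (x : R) (k n : nat) :
  x + k%:R = 0 -> (k <= n)%N -> gauss_prod x n = 0.
Proof.
move=> xk kn; rewrite /gauss_prod (bigD1 (Ordinal (kn : (k < n.+1)%N))) //= xk.
by rewrite !mul0r.
Qed.

(** For [y >= 1], passing from [y] to [y + 1] multiplies by [(y + N + 2) / (y (N + 1)) <= 3],
    uniformly in [N]. Geometric growth in [n] is harmless against the [1/n!] of the start
    polynomial. *)
Lemma gauss_prod_bound (R : realType) (x : R) :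
  exists K, forall N n, `|gauss_prod (n%:R + x) N.+1| <= K * 3 ^+ n.
Proof.
have bnd (y : R) : exists B, forall N, `|gauss_prod y N.+1| <= B.
  have [M [_ hM]] := cvg_seq_bounded (@is_cvg_gauss_prod _ y).
  by exists (M + 1) => N; apply: hM => //; rewrite ltrDl.
move: x; apply: shift_pos_ind => [x x1|x [K hK]]; have [B hB] := bnd x.
  exists B => N; elim=> [|n IHn]; first by rewrite add0r mulr1.
  rewrite -natr1 -addrA [1 + x]addrC addrA.
  have y1 : 1 <= n%:R + x by rewrite ler_wpDl.
  move: (n%:R + x) y1 IHn => y y1 IHn.
  have y0 : 0 < y by lra.
  have N0 : 0 < N.+1%:R :> R by [].
  have := gauss_prod_rec y N; rewrite -[N.+2%:R]natr1 => e.
  have -> : gauss_prod (y + 1) N.+1 =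
      (y + (N.+1%:R + 1)) / (y * N.+1%:R) * gauss_prod y N.+1.
    rewrite mulrAC -e; field.
    by rewrite nat1r pnatr_eq0 lt0r_neq0.
  rewrite normrM exprS mulrCA [leRHS]mulrC.
  rewrite mulrC; apply: ler_pM => //.
  rewrite ger0_norm; last by rewrite divr_ge0 ?addr_ge0 ?mulr_ge0 ?ltW.
  rewrite ler_pdivrMr ?mulr_gt0 //.
  have N1 : 1 <= N.+1%:R :> R by rewrite ler1n.
  nra.
(* Descending from [x + 1] to [x] shifts [n] by one, so only [n = 0] is new; [B] covers it. *)
exists (Num.max B K) => N [|n].
  by rewrite add0r mulr1 le_max hB.
rewrite -natr1 -addrA [1 + x]addrC; apply: le_trans (hK N n) _.
rewrite exprS mulrCA.
have t0 : 0 <= 3 ^+ n :> R by rewrite exprn_ge0.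
have K3 : 0 <= K * 3 ^+ n by apply: le_trans (hK N n).
have : K * 3 ^+ n <= Num.max B K * 3 ^+ n by rewrite ler_wpM2r // le_max lexx orbT.
lra.
Qed.

(** * Approximation of the two series *)

Lemma near_forall_lt (Q : nat -> nat -> Prop) n0 :
  (forall n, (n < n0)%N -> \forall N \near \oo, Q n N) ->
  \forall N \near \oo, forall n, (n < n0)%N -> Q n N.
Proof.
elim: n0 => [|n0 IH] h; first by near=> N => n.
have {}IH := IH (fun n nn => h n (ltnW nn)); have h0 := h n0 (leqnn _).
near=> N => n; rewrite ltnS leq_eqVlt => /orP[/eqP ->|]; first by near: N.
by move: n; near: N.
Unshelve. all: by end_near. Qed.

Lemma pos_rootedZ (R : realType) M (b : R) (p : {poly R}) : b != 0 ->
  pos_rooted M p -> pos_rooted M (b *: p).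
Proof.
move=> b0 [T [pT rT sT]]; exists T; rewrite size_scale //; split=> //.
by apply/allP => x xT; rewrite rootZ //; exact: (allP rT).
Qed.

Definition gamma_coef (R : realType) (al be : R) (n : nat) : R :=
  (-1) ^+ n / n`!%:R * rGamma (n%:R + al) * rGamma ((2 * n)%:R + be).

(** The power of 2 undoes the halving in [(be + k) / 2], and the two quotients are the parts of the
    Gauss denominators free of [n]. The scale [N.+1 ^- 3] supplies the rest, [N.+1 ^ n] for [al] and
    [N.+1 ^ (2 n)] for [be]. *)
Definition gamma_approx (R : realType) (al be : R) (N : nat) : {poly R} :=
  (2 ^+ N.+2 / (N.+1`!%:R * N.+1%:R `^ al) / (N.+1`!%:R * N.+1%:R `^ be)) *:
  iteri N.+2 (fun k => theta ((be + k%:R) / 2))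
    (iteri N.+2 (fun k => theta (al + k%:R)) (start_poly (N.+1%:R ^- 3) N)).

Lemma coef_gamma_approx (R : realType) (al be : R) N n :
  (gamma_approx al be N)`_n =
  (start_poly (N.+1%:R ^- 3) N)`_n / (N.+1%:R ^- 3) ^+ n *
  gauss_prod (n%:R + al) N.+1 * gauss_prod ((2 * n)%:R + be) N.+1.
Proof.
rewrite coefZ (coef_iter_theta (fun k => (be + k%:R) / 2)).
rewrite (coef_iter_theta (fun k => al + k%:R)).
have -> : \prod_(k < N.+2) (n%:R + (be + k%:R) / 2) =
    2 ^- N.+2 * \prod_(k < N.+2) ((2 * n)%:R + be + k%:R).
  rewrite -exprVn -[X in _ ^+ X]card_ord -prodr_const -big_split /=.
  by apply: eq_bigr => k _; rewrite natrM; field.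
have -> : \prod_(k < N.+2) (n%:R + (al + k%:R)) = \prod_(k < N.+2) (n%:R + al + k%:R).
  by apply: eq_bigr => k _; rewrite addrA.
have N0 : 0 < N.+1%:R :> R by [].
have N1 := lt0r_neq0 N0.
rewrite /gauss_prod.
have -> : N.+1%:R `^ (n%:R + al) = N.+1%:R ^+ n * N.+1%:R `^ al.
  by rewrite powRD ?N1 ?implybT // powR_mulrn.
have -> : N.+1%:R `^ ((2 * n)%:R + be) = N.+1%:R ^+ n * N.+1%:R ^+ n * N.+1%:R `^ be.
  by rewrite powRD ?N1 ?implybT // powR_mulrn // mul2n -addnn exprD.
have -> : (N.+1%:R ^- 3) ^+ n =
    (N.+1%:R ^+ n * (N.+1%:R ^+ n * N.+1%:R ^+ n))^-1 :> R.
  by rewrite exprVn -exprM mulnC exprM exprS expr2.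
have := powR_gt0 al N0; have := powR_gt0 be N0.
have := exprn_gt0 n N0; have : 0 < N.+1`!%:R :> R by rewrite ltr0n fact_gt0.
have : 0 < 2 ^+ N.+2 :> R by rewrite exprn_gt0.
move: (N.+1%:R `^ al) (N.+1%:R `^ be) (N.+1%:R ^+ n) (N.+1`!%:R) (2 ^+ N.+2).
move=> x1 x2 x3 x4 x5 h5 h4 h3 h2 h1.
move: (\prod_(k < _) _) (\prod_(k < _) _) (_`_n) => y1 y2 y3.
by field; rewrite !gt_eqF.
Qed.

Lemma gamma_approx_cvg (R : realType) (al be : R) n :
  (fun N => (gamma_approx al be N)`_n) @ \oo --> gamma_coef al be n.
Proof.
have g (x : R) : (fun N => gauss_prod x N.+1) @ \oo --> rGamma x.
  by rewrite cvg_shiftS; exact: cvg_gauss_prod.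
have s0 (N : nat) : 0 < N.+1%:R ^- 3 :> R by rewrite invr_gt0 exprn_gt0.
apply: cvg_ext (cvgM (cvgM (@start_coef_cvg _ _ n s0) (g (n%:R + al)))
  (g ((2 * n)%:R + be))) => N /=.
by rewrite coef_gamma_approx.
Qed.

(** [54 = 2 * 3 * 3 ^ 2]: the start polynomial gives [2^n / n!], the two Gauss products give [3^n]
    and [3^(2 n)], and [x^n / n!] is at most [exp(x)]. *)
Lemma gamma_approx_dominated (R : realType) (al be : R) :
  exists K, forall rho N n, 0 < rho ->
    `|(gamma_approx al be N)`_n| * rho ^+ n <= K * expR (54 * rho).
Proof.
have [K1 h1] := gauss_prod_bound al; have [K2 h2] := gauss_prod_bound be.
exists (K1 * K2) => rho N n rho0; rewrite coef_gamma_approx 2!normrM.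
have s0 : 0 < N.+1%:R ^- 3 :> R by rewrite invr_gt0 exprn_gt0.
have h0 := start_coef_le N n s0.
have := ler_pM (mulr_ge0 (normr_ge0 _) (normr_ge0 _)) (normr_ge0 _)
  (ler_pM (normr_ge0 _) (normr_ge0 _) h0 (h1 N n))
  (h2 N (2 * n)%N).
have rn : 0 <= rho ^+ n by rewrite exprn_ge0 ?ltW.
move=> h; apply: le_trans (ler_wpM2r rn (le_trans _ h)) _; first by [].
have K10 : 0 <= K1 by have := h1 0%N 0%N; rewrite mulr1; exact: le_trans.
have K20 : 0 <= K2 by have := h2 0%N 0%N; rewrite mulr1; exact: le_trans.
have -> : 2 ^+ n / n`!%:R * (K1 * 3 ^+ n) * (K2 * 3 ^+ (2 * n)) * rho ^+ n =
    K1 * K2 * ((54 * rho) ^+ n / n`!%:R).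
  rewrite exprM exprMn (_ : 54 = 2 * 3 * 3 ^+ 2 :> R); last by rewrite -!natrX -!natrM.
  by rewrite !exprMn; ring.
rewrite ler_wpM2l ?mulr_ge0 //.
have r0 : 0 <= 54 * rho by rewrite mulr_ge0 // ltW.
case: n {h rn h0} => [|n]; first by
  apply: le_trans (expR_ge1Dx _); rewrite expr0 fact0 divr1 lerDl.
by apply: le_trans (expR_ge1Dxn n r0); rewrite lerDr.
Qed.

Lemma gamma_approx_pos_rooted (R : realType) (al be : R) N M :
  (\sum_(k < N.+2) (al + k%:R <= 0)%R + \sum_(k < N.+2) (be + k%:R <= 0)%R <= M)%N ->
  pos_rooted M (gamma_approx al be N).
Proof.
have N0 : 0 < N.+1%:R :> R by [].
move=> hM; apply: pos_rootedZ.
  have d0 x : 0 < N.+1`!%:R * N.+1%:R `^ x :> R.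
    by rewrite mulr_gt0 ?powR_gt0 // ltr0n fact_gt0.
  by apply: lt0r_neq0; rewrite divr_gt0 // divr_gt0 // exprn_gt0.
have s0 : 0 < N.+1%:R ^- 3 :> R by rewrite invr_gt0 exprn_gt0.
have h1 := pos_rooted_iter_theta (fun k => al + k%:R) N.+2 (start_pos_rooted N s0).
have [T [pT rT sT]] := pos_rooted_iter_theta (fun k => (be + k%:R) / 2) N.+2 h1.
exists T; split=> //; apply: leq_trans sT _.
rewrite !leq_add2r leq_add2l (leq_trans _ hM) // add0n leq_add2l.
by apply: leq_sum => k _; rewrite pmulr_lle0 ?invr_gt0.
Qed.

(** For large [N] the first [k0] coefficients of the approximants vanish exactly, not just in the
    limit, so the power [X^k0] can be divided out of them too. *)
Lemma gamma_limit (R : realType) (al be : R) k0 M :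
  (forall n, (n < k0)%N -> exists j : nat, n%:R + al + j%:R = 0) ->
  gamma_coef al be k0 != 0 ->
  (forall N, \sum_(k < N) (al + k%:R <= 0)%R + \sum_(k < N) (be + k%:R <= 0)%R <= M)%N ->
  real_rooted_limit M (fun n => (gamma_coef al be (k0 + n))%:C).
Proof.
move=> hk c0 hM; have [K hK] := gamma_approx_dominated al be.
exists (fun rho => K * expR (54 * rho) / rho ^+ k0) => eps n0 eps0.
(* The second entry keeps the constant coefficient of [p] nonzero, as [pos_rooted_fprod]
   requires. *)
have e1 : 0 < Num.min eps `|gamma_coef al be k0| by rewrite lt_min eps0 normr_gt0.
have [N _ hN] : \forall N \near \oo,
    (forall n, (n < k0)%N -> (gamma_approx al be N)`_n = 0) /\
    (forall n, (n < n0.+1)%N ->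
      `|gamma_coef al be (k0 + n) - (gamma_approx al be N)`_(k0 + n)| <
      Num.min eps `|gamma_coef al be k0|).
  apply/near_andP; split; apply: near_forall_lt => n nn.
    have [j hj] := hk n nn; exists j => // N /= jN.
    by rewrite coef_gamma_approx (gauss_prod_eq0 hj) ?mulr0 ?mul0r // ltnW.
  by have /cvgrPdist_lt/(_ _ e1) := @gamma_approx_cvg _ al be (k0 + n)%N.
have [vanish close] := hN N (leqnn N).
set p := drop_poly k0 (gamma_approx al be N).
have pE n : p`_n = (gamma_approx al be N)`_(k0 + n) by rewrite coef_drop_poly addnC.
have pr : pos_rooted M p.
  by apply: pos_rooted_drop => //; exact: gamma_approx_pos_rooted.
have p0 : p`_0 != 0.
  rewrite pE; have := close 0%N isT; rewrite lt_min addn0 => /andP[_].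
  by apply: contraTneq => ->; rewrite subr0 ltxx.
have [a [U [T [sU Tp e]]]] := pos_rooted_fprod pr p0.
exists a, U, T; rewrite /approximant -e; split=> //.
  move=> rho n rho0; rewrite coef_map normcR pE.
  rewrite ler_pdivlMr ?exprn_gt0 // -mulrA -exprD addnC.
  exact: hK.
move=> n nn; rewrite coef_map pE -(rmorphB (real_complex R)) normcR distrC ltW //.
by have := close n nn; rewrite lt_min => /andP[].
Qed.

(** * The two functions as instances, and the count of nonpositive parameters *)

Lemma funA_coefE (R : realType) (nu : R) : funA_coef nu = gamma_coef (nu + 1) (nu + 2).
Proof.
apply: funext => n; rewrite /funA_coef /gamma_coef.
by congr (_ * rGamma _ * rGamma _); ring.
Qed.

Lemma funB_coefE (R : realType) (nu : R) : funB_coef nu = gamma_coef (nu + 1) (nu + 1).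
Proof.
apply: funext => n; rewrite /funB_coef /gamma_coef.
by congr (_ * rGamma _ * rGamma _); ring.
Qed.

Lemma funA_sqrt_ev (R : realType) (nu : R) (z : R[i]) :
  funA_sqrt nu z = 2 * ev (fun n => (gamma_coef (nu + 1) (nu + 2) n)%:C) z.
Proof. by rewrite -funA_coefE. Qed.

Lemma funB_sqrt_ev (R : realType) (nu : R) (z : R[i]) :
  funB_sqrt nu z = ev (fun n => (gamma_coef (nu + 1) (nu + 1) n)%:C) z.
Proof. by rewrite -funB_coefE. Qed.

Lemma gamma_coef_vanish (R : realType) (al be : R) k0 n :
  (forall n, (n < k0)%N -> exists j : nat, n%:R + al + j%:R = 0) ->
  (n < k0)%N -> gamma_coef al be n = 0.
Proof. by move=> h /h[j hj]; rewrite /gamma_coef (rGamma_eq0 hj) mulr0 mul0r. Qed.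

Lemma gamma_coef_neq0 (R : realType) (al be : R) n :
  rGamma (n%:R + al) != 0 -> rGamma ((2 * n)%:R + be) != 0 ->
  gamma_coef al be n != 0.
Proof.
by move=> h1 h2; rewrite /gamma_coef !mulf_neq0 ?expf_neq0 ?oppr_eq0 ?oner_neq0.
Qed.

Lemma sum_nonpos_le (R : realType) (x : R) (m N : nat) :
  0 < x + m%:R -> (\sum_(k < N) (x + k%:R <= 0)%R <= m)%N.
Proof.
(* Only indices below [m] contribute; the minimum with [N] is what makes the induction on [N]
   close. *)
move=> xm; suff : (\sum_(k < N) (x + k%:R <= 0)%R <= minn N m)%N.
  by rewrite leq_min => /andP[].
elim: N => [|N IHN]; first by rewrite big_ord0.
rewrite big_ord_recr /=; have [h|h] := leP (x + N%:R) 0; last first.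
  by rewrite addn0; apply: leq_trans IHN _; lia.
have : (N < m)%N by rewrite -(ltr_nat R); lra.
by rewrite addn1 => Nm; apply: leq_ltn_trans IHN _; lia.
Qed.

Lemma gamma_pos_zeros (R : realType) (al be : R) (z : R[i]) : 0 < al -> 0 < be ->
  ev (fun n => (gamma_coef al be n)%:C) z = 0 -> 0 < z.
Proof.
move=> al0 be0.
have c0 : gamma_coef al be 0 != 0.
  by apply: gamma_coef_neq0; rewrite gt_eqF // rGamma_gt0 // ?add0r // addr0.
apply: positive_zeros.
  have := @gamma_limit R al be 0 0; apply=> // N.
  rewrite leqn0 addn_eq0 -!leqn0.
  by apply/andP; split; apply: sum_nonpos_le; rewrite addr0.
by apply: contraNneq c0 => /complexI ->.
Qed.

Lemma gamma_neg_zeros (R : realType) (nu : R) (r : nat) (b : R[i]) :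
  0 <= nu -> (0 < r)%N -> b != 0 ->
  at_most_nonreal_zeros (fun z =>
    b * ev (fun n => (gamma_coef (- nu + 1) (- nu + r%:R) n)%:C) (z ^+ 2))
    (4 * Num.truncn nu).
Proof.
move=> nu0 r0 b0; set t := Num.truncn nu.
have tnu : nu < t.+1%:R by exact: truncnS_gt.
have r1 : 1 <= r%:R :> R by rewrite ler1n.
(* If [nu] is the integer [t], then [1/Gamma(n + 1 - t)] vanishes for [n < t] but not at [n = t];
   for other [nu] the constant coefficient is already nonzero. *)
pose k0 := if nu == t%:R then t else 0%N.
have vanish n : (n < k0)%N -> exists j : nat, n%:R + (- nu + 1) + j%:R = 0.
  rewrite /k0; case: eqP => // -> nt; exists (t - n.+1)%N.
  by rewrite natrB // -[n.+1%:R]natr1; ring.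
have ck0 : gamma_coef (- nu + 1) (- nu + r%:R) k0 != 0.
  apply: gamma_coef_neq0; rewrite /k0; case: (nu =P t%:R) => [nut|nut].
  - by rewrite gt_eqF // rGamma_gt0 // -nut; lra.
  - apply: rGamma_neq0 => k; rewrite add0r; apply/eqP => e; apply: nut.
    have nuk : nu = k.+1%:R by rewrite -natr1; lra.
    by rewrite /t nuk natrK.
  - rewrite gt_eqF // rGamma_gt0 // natrM -nut; lra.
  - apply: rGamma_neq0 => k; rewrite muln0 add0r; apply/eqP => e; apply: nut.
    have nuk : nu = (r + k)%:R by rewrite natrD; lra.
    by rewrite /t nuk natrK.
(* Each parameter sequence is positive from index [t] on, since [nu < t + 1] and [1 <= r]; the outer
   2 comes from [z ^+ 2]. *)
have -> : (4 * t = 2 * (t + t))%N by lia.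
apply: (@nonreal_zeros_le R _ k0) => //.
- by move=> n nk; rewrite (gamma_coef_vanish _ vanish nk).
- by apply: contraNneq ck0 => /complexI ->.
- apply: gamma_limit => // N; apply: leq_add; apply: sum_nonpos_le;
    by move: tnu; rewrite -natr1; lra.
Qed.

Theorem theorem5 (R : realType) (nu : R) :
  (-1 < nu ->
     (forall z : R[i], funA nu z = 0 -> z \is Num.real) /\
     (forall z : R[i], funB nu z = 0 -> z \is Num.real)) /\
  (-1 < nu ->
     (forall z : R[i], funA_sqrt nu z = 0 -> z \is Num.real /\ 0 < z) /\
     (forall z : R[i], funB_sqrt nu z = 0 -> z \is Num.real /\ 0 < z)) /\
  (0 <= nu ->
     at_most_nonreal_zeros (funA (- nu)) (4 * Num.truncn nu) /\
     at_most_nonreal_zeros (funB (- nu)) (4 * Num.truncn nu)).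
Proof.
have posA : -1 < nu -> forall z : R[i], funA_sqrt nu z = 0 -> 0 < z.
  move=> nu1 z; rewrite funA_sqrt_ev => /eqP.
  rewrite mulf_eq0 pnatr_eq0 /= => /eqP; apply: gamma_pos_zeros; lra.
have posB : -1 < nu -> forall z : R[i], funB_sqrt nu z = 0 -> 0 < z.
  by move=> nu1 z; rewrite funB_sqrt_ev; apply: gamma_pos_zeros; lra.
split; last split.
- move=> nu1; split=> z; rewrite -?funA_sqrtE -?funB_sqrtE.
    by move=> /(posA nu1)/ltW/sqr_ge0_real.
  by move=> /(posB nu1)/ltW/sqr_ge0_real.
- move=> nu1; split=> z.
    by move=> /(posA nu1) z0; split=> //; exact: gtr0_real.
  by move=> /(posB nu1) z0; split=> //; exact: gtr0_real.
- move=> nu0; split.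
    have -> : funA (- nu) = fun z => 2 * ev (fun n =>
        (gamma_coef (- nu + 1) (- nu + 2%:R) n)%:C) (z ^+ 2).
      by apply: funext => z; rewrite -funA_sqrt_ev funA_sqrtE.
    by apply: gamma_neg_zeros; rewrite ?pnatr_eq0.
  have -> : funB (- nu) = fun z => 1 * ev (fun n =>
      (gamma_coef (- nu + 1) (- nu + 1%:R) n)%:C) (z ^+ 2).
    by apply: funext => z; rewrite mul1r -funB_sqrt_ev funB_sqrtE.
  by apply: gamma_neg_zeros; rewrite ?oner_neq0.
Qed.
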